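(* Consider the Rescaled Pólya urn with $k\ge2$ colors and parameters $\alpha>0$ and $\beta=0$. Let $\gamma=\frac{\alpha}{|\boldsymbol{b}_0|+\alpha}$ and $\lambda=1+\frac{2\gamma}{1-\gamma}$. Then, as $N\to\infty$, $\overline{\boldsymbol{\xi}}_N\to\boldsymbol{p}_0$ almost surely and $$\sqrt{N}\,(\overline{\boldsymbol{\xi}}_N-\boldsymbol{p}_0)=\frac{\sum_{n=1}^N(\boldsymbol{\xi}_n-\boldsymbol{p}_0)}{\sqrt N}\ \xrightarrow{\ d\ }\ \mathcal{N}(\boldsymbol{0},\Sigma^2),\qquad \Sigma^2=\lambda\big(\mathrm{diag}(\boldsymbol{p}_0)-\boldsymbol{p}_0\boldsymbol{p}_0^\top\big).$$
   Context: For $x\in\mathbb{R}^k$, $|x|=\sum_{i=1}^k|x_i|$; $e_1,\dots,e_k$ is the canonical basis of $\mathbb{R}^k$. Rescaled Pólya (RP) urn with $k$ colors and parameters $\alpha,\beta$: let $\boldsymbol{b}_0=(b_{0,1},\dots,b_{0,k})^\top$ and $\boldsymbol{B}_0=(B_{0,1},\dots,B_{0,k})^\top$ be deterministic vectors with nonnegative real entries such that $|\boldsymbol{b}_0|>0$ and $b_{0,i}+B_{0,i}>0$ for every $i$. The draws $\boldsymbol{\xi}_n=(\xi_{n,1},\dots,\xi_{n,k})^\top$, $n\ge1$, are random vectors with values in $\{e_1,\dots,e_k\}$. Set $\boldsymbol{B}_{n}=\beta\boldsymbol{B}_{n-1}+\alpha\boldsymbol{\xi}_{n}$ for $n\ge1$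 (so $\boldsymbol{B}_n=\alpha\boldsymbol{\xi}_n$ when $\beta=0$), and $\boldsymbol{N}_n=\boldsymbol{b}_0+\boldsymbol{B}_n$ for $n\ge0$. With $\mathcal{F}_0$ trivial and $\mathcal{F}_n=\sigma(\boldsymbol{\xi}_1,\dots,\boldsymbol{\xi}_n)$, the law of the draws is determined by $$P(\xi_{n+1,i}=1\mid\mathcal{F}_n)=\psi_{n,i},\qquad \boldsymbol{\psi}_n=\frac{\boldsymbol{N}_n}{|\boldsymbol{N}_n|}=\frac{\boldsymbol{b}_0+\boldsymbol{B}_n}{|\boldsymbol{b}_0|+|\boldsymbol{B}_n|},\qquad n\ge0.$$ Set $\boldsymbol{p}_0=\boldsymbol{b}_0/|\boldsymbol{b}_0|$ and $\overline{\boldsymbol{\xi}}_N=\frac1N\sum_{n=1}^N\boldsymbol{\xi}_n$. $\xrightarrow{d}$ is convergence in distribution; Gaussian laws may be degenerate. *)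

(* Defs.v *)
From HB Require Import structures.
From mathcomp Require Import all_boot all_order all_algebra.
From mathcomp Require Import all_classical all_reals all_analysis.

Set Implicit Arguments.
Unset Strict Implicit.
Unset Printing Implicit Defensive.

Import Order.TTheory GRing.Theory Num.Theory.
Import numFieldNormedType.Exports.
Local Open Scope classical_set_scope.
Local Open Scope ring_scope.

(* MathComp-Analysis puts a topology but no sigma-algebra on matrices: this is
   'cV[R]_k equipped with its Borel sigma-algebra. *)
Definition borel_vec (R : realType) (k : nat) :=
  g_sigma_algebraType (@open 'cV[R]_k).

Definition norm1 (R : realType) (k : nat) (x : 'cV[R]_k) : R :=
  \sum_(i < k) `|x i 0|.

(* The sigma-algebra generated by xi 1, ..., xi n; index 0 is not a draw. *)
Definition draws_sigma (R : realType) (d : measure_display)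
    (T : measurableType d) (k : nat) (xi : nat -> T -> borel_vec R k)
    (n : nat) : set (set T) :=
  <<s \bigcup_(m in [set m | (1 <= m <= n)%N])
        preimage_set_system setT (xi m) measurable >>.

(* Y is a version of the conditional probability P(A | G), i.e. of E[1_A | G]. *)
Definition is_cond_prob (R : realType) (d : measure_display)
    (T : measurableType d) (P : probability T R) (G : set (set T))
    (A : set T) (Y : T -> R) : Prop :=
  [/\ forall V : set R, measurable V -> G (Y @^-1` V),
      P.-integrable setT (EFin \o Y)
    & forall C : set T, G C -> P (A `&` C) = (\int[P]_(w in C) (Y w)%:E)%E].

Fixpoint urn_B (R : realType) (k : nat) (alpha beta : R) (B0 : 'cV[R]_k)
    (x : nat -> 'cV[R]_k) (n : nat) : 'cV[R]_k :=
  if n is m.+1 then beta *: urn_B alpha beta B0 x m + alpha *: x n else B0.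

Definition urn_N (R : realType) (k : nat) (alpha beta : R) (b0 B0 : 'cV[R]_k)
    (x : nat -> 'cV[R]_k) (n : nat) : 'cV[R]_k :=
  b0 + urn_B alpha beta B0 x n.

Definition urn_psi (R : realType) (k : nat) (alpha beta : R)
    (b0 B0 : 'cV[R]_k) (x : nat -> 'cV[R]_k) (n : nat) : 'cV[R]_k :=
  (norm1 (urn_N alpha beta b0 B0 x n))^-1 *: urn_N alpha beta b0 B0 x n.

(* The draws are xi 1, xi 2, ...; nothing is assumed about xi 0. *)
Record rescaled_polya_urn (R : realType) (d : measure_display)
    (T : measurableType d) (P : probability T R) (k : nat) (alpha beta : R)
    (b0 B0 : 'cV[R]_k) (xi : nat -> T -> 'cV[R]_k) : Prop :=
  RescaledPolyaUrn {
    urn_b0_ge0 : forall i, 0 <= b0 i 0;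
    urn_B0_ge0 : forall i, 0 <= B0 i 0;
    urn_b0_gt0 : 0 < norm1 b0;
    urn_init_gt0 : forall i, 0 < b0 i 0 + B0 i 0;
    urn_draw_measurable : forall n, (1 <= n)%N ->
      measurable_fun setT (xi n : T -> borel_vec R k);
    urn_draw_basis : forall n w, (1 <= n)%N ->
      exists i : 'I_k, xi n w = delta_mx i 0;
    urn_draw_law : forall (n : nat) (i : 'I_k),
      is_cond_prob P (draws_sigma (xi : nat -> T -> borel_vec R k) n)
        [set w | xi n.+1 w i 0 = 1]
        (fun w => urn_psi alpha beta b0 B0 (fun m => xi m w) n i 0) }.

Definition draws_mean (R : realType) (T : Type) (k : nat)
    (xi : nat -> T -> 'cV[R]_k) (N : nat) (w : T) : 'cV[R]_k :=
  N%:R^-1 *: \sum_(1 <= n < N.+1) xi n w.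

(* The normal law on R with mean m and variance v >= 0. The library's
   normal_prob is parameterized by the standard deviation and is not the Dirac
   mass when that deviation is 0. *)
Definition normal_law (R : realType) (m v : R) : set R -> \bar R :=
  if v == 0 then dirac m else normal_prob m (Num.sqrt v).

(* nu is the (possibly degenerate) law N(m, S) on R^k: every linear form t^T x
   has law N(t^T m, t^T S t) under nu. *)
Definition is_gaussian (R : realType) (k : nat) (m : 'cV[R]_k) (S : 'M[R]_k)
    (nu : probability (borel_vec R k) R) : Prop :=
  forall (t : 'cV[R]_k) (V : set R), measurable V ->
    nu [set x : 'cV[R]_k | V ((t^T *m x) 0 0)] =
    normal_law ((t^T *m m) 0 0) ((t^T *m S *m t) 0 0) V.

Definition cvg_in_distribution (R : realType) (d : measure_display)
    (T : measurableType d) (P : probability T R) (k : nat)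
    (X : nat -> T -> 'cV[R]_k) (nu : probability (borel_vec R k) R) : Prop :=
  forall f : 'cV[R]_k -> R, continuous f ->
    (exists M : R, forall x, `|f x| <= M) ->
    (\int[P]_w (f (X N w))%:E)%E @[N --> \oo] -->
    (\int[nu]_x (f x)%:E)%E.

(* Main.v *)
Require Import Defs.
From HB Require Import structures.
From mathcomp Require Import all_boot all_order all_algebra.
From mathcomp Require Import all_classical all_reals all_analysis.
From mathcomp Require Import measurable_realfun.
From mathcomp Require Import ring lra.

Import Order.TTheory GRing.Theory Num.Theory.
Import numFieldNormedType.Exports.
Local Open Scope classical_set_scope.
Local Open Scope ring_scope.

(** Why the theorem is true.

    When [beta = 0] the composition of the urn before a draw depends only on
    the previous draw, and the draws form a Markov chain with a simple kernel:
    with probability [gamma] the previous colour is repeated, otherwise a fresh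
    colour is sampled from [p0] (lemma [next_draw]).  Fix a vector [t] and put
    [Y_n = t . (xi_n - p0)], [S_n = Y_1 + ... + Y_n].  Since [p0] averages
    [t . (e_j - p0)] to zero, the conditional expectation of [Y_(n+1)] is
    [gamma Y_n], so [M_n = (1 - gamma) S_n + gamma Y_n] is a martingale with
    bounded increments, at bounded distance from [(1 - gamma) S_n].

    Strong law.  The fourth moment of [M_n] is [O(n ^ 2)], so the expectations
    of [(M_n / n) ^ 4] are summable and [M_n / n] tends to [0] almost surely
    ([fourth_moment_M], [ae_cvg0_summable], [S_slln]).

    Central limit theorem for [t].  With [q] the variance of [t . e_j] under
    [p0] and [h = Y ^ 2 - q], the conditional variance of the increment of [M]
    is [(1 - gamma ^ 2) q + gamma (1 - gamma) h], and one step of the chain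
    multiplies [h] by [gamma].  Hence the perturbed character
    [cos (th + s M_n) (1 - s ^ 2 gamma / 2 h)] is reproduced by conditional
    expectation up to a constant factor and an error [O(s ^ 3)] ([Phi_step]).
    That factor is the characteristic function [gauss_char] of the normal law
    at variance [s ^ 2 (1 - gamma ^ 2) q].  As [gauss_char] turns sums of
    variances into products, [N] such factors with
    [s = 1 / ((1 - gamma) sqrt N)] multiply to [gauss_char (lambda q)] exactly,
    and the total error [O(s) + N * O(s ^ 3)] tends to [0] ([char_S_cvg]).

    Limit law.  The covariance [lambda (diag p0 - p0 p0^T)] is the sum over the
    colours [j] of [lambda p0_j (e_j - p0) (e_j - p0)^T].  The limit is
    therefore the law of a sum of independent standard normal multiples of the
    vectors [sqrt (lambda p0_j) (e_j - p0)], whose linear forms are normal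
    because independent normal variables add up to a normal variable
    ([std_convolution], [exists_gaussian_sum]).

    From characters to bounded continuous functions.  Second moments are
    bounded, so only a large box matters up to a small error.  There a
    continuous function is uniformly close to a Bernstein polynomial in the
    variables [(1 + sin (x_i / L)) / 2]; this is a trigonometric polynomial with
    the same bound as the function on the whole space, and its expectation
    converges by the previous step ([trig_approximation],
    [cvg_in_distribution_char]). *)

Set Implicit Arguments.
Unset Strict Implicit.
Unset Printing Implicit Defensive.

(** * Affine images of the Lebesgue measure and of normal laws *)

Section affine.
Context {R : realType}.
Local Notation mu := (@lebesgue_measure R).

(** The Lebesgue measure is determined by its values on bounded intervals, and
    an affine map pulls an interval back to an interval, reversed when [a] is
    negative. *)
Lemma lebesgue_measure_affine (a b : R) (A : set R) : a != 0 -> measurable A ->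
  mu A = (`|a|%:E * mu ((fun x : R => a * x + b)%R @^-1` A))%E.
Proof.
move=> a0 mA.
pose phi : measurableTypeR R -> measurableTypeR R := fun x => a * x + b.
have mphi : measurable_fun setT phi.
  by apply: measurable_funD => //; apply: measurable_funM.
apply: (@lebesgue_measure_unique _
  (mscale (NngNum (normr_ge0 a)) (pushforward mu phi))) => // _ [[u v]] _ <-.
change (mu `]u, v] = (`|a|%:E * mu (phi @^-1` `]u, v]))%E).
have aa : 0 < `|a| by rewrite normr_gt0.
have [apos|aneg|/eqP] := ltgtP 0 a; last by rewrite eq_sym (negbTE a0).
- rewrite (_ : phi @^-1` _ = `](u - b) / a, (v - b) / a]%classic); last first.
    apply/seteqP; split => x; rewrite /phi /= !in_itv/= => /andP[h1 h2].
      by rewrite ltr_pdivrMr// ler_pdivlMr//; apply/andP; split; lra.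
    move: h1 h2; rewrite ltr_pdivrMr// ler_pdivlMr// => h1 h2.
    by apply/andP; split; lra.
  rewrite !lebesgue_measure_itv/= !lte_fin ltr_pM2r ?invr_gt0// ltrD2r.
  case: ifPn => _; last by rewrite mule0.
  by rewrite -!EFinD -EFinM gtr0_norm//; congr EFin; field.
- rewrite (_ : phi @^-1` _ = `[(v - b) / a, (u - b) / a[%classic); last first.
    apply/seteqP; split => x; rewrite /phi /= !in_itv/= => /andP[h1 h2].
      by rewrite ler_ndivrMr// ltr_ndivlMr//; apply/andP; split; lra.
    move: h1 h2; rewrite ler_ndivrMr// ltr_ndivlMr// => h1 h2.
    by apply/andP; split; lra.
  rewrite !lebesgue_measure_itv/= !lte_fin ltr_nM2r ?invr_lt0// ltrD2r.
  case: ifPn => _; last by rewrite mule0.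
  by rewrite -!EFinD -EFinM ltr0_norm//; congr EFin; field.
Qed.

Lemma ge0_integral_affine (a b : R) (f : R -> \bar R) : a != 0 ->
  measurable_fun setT f -> (forall x, 0 <= f x)%E ->
  (\int[mu]_x f x = `|a|%:E * \int[mu]_x f (a * x + b)%R)%E.
Proof.
move=> a0 mf f0.
pose phi : measurableTypeR R -> measurableTypeR R := fun x => a * x + b.
have mphi : measurable_fun setT phi.
  by apply: measurable_funD => //; apply: measurable_funM.
have -> : (\int[mu]_x f (a * x + b)%R)%E = (\int[pushforward mu phi]_x f x)%E.
  by rewrite ge0_integral_pushforward.
rewrite -(@ge0_integral_mscale _ _ _ _ _ _ (NngNum (normr_ge0 a)))//.
by apply: eq_measure_integral => A mA _; exact: lebesgue_measure_affine.
Qed.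

End affine.

Section normal.
Context {R : realType}.
Local Notation mu := (@lebesgue_measure R).

(** The density of a normal law agrees almost everywhere with its Radon-Nikodym
    derivative, along which integrals can be transferred. *)
Lemma ge0_integral_normal_prob (m s : R) (f : R -> \bar R) :
  measurable_fun setT f -> (forall x, 0 <= f x)%E ->
  (\int[normal_prob m s]_x f x = \int[mu]_x (f x * (normal_pdf m s x)%:E))%E.
Proof.
move=> mf f0.
rewrite -(Radon_Nikodym_SigmaFinite.change_of_variables
  (normal_prob_dominates m s))//.
have fint := Radon_Nikodym_SigmaFinite.f_integrable (normal_prob_dominates m s).
apply: ae_eq_integral => //.
- by apply: emeasurable_funM => //; exact: measurable_int fint.
- apply: emeasurable_funM => //; apply/measurable_EFinP.
  exact: measurable_normal_pdf.
- apply: ae_eqe_mul2l; apply: integral_ae_eq => //.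
  + by apply/measurable_EFinP; exact: measurable_normal_pdf.
  + move=> E _ mE.
    by rewrite -(Radon_Nikodym_SigmaFinite.f_integral (normal_prob_dominates m s)).
Qed.

Lemma normal_pdf_affine (m s x : R) : s != 0 ->
  `|s| * normal_pdf m s (s * x + m) = normal_pdf 0 1 x.
Proof.
move=> s0; rewrite !normal_pdfE ?oner_eq0//= /normal_peak /normal_fun.
rewrite expr1n mul1r subr0 addrK.
have -> : - (s * x) ^+ 2 / (s ^+ 2 *+ 2) = - x ^+ 2 / (1 *+ 2) by field.
rewrite mulrA; congr (_ * _).
rewrite -mulrnAr sqrtrM ?sqr_ge0// sqrtr_sqr invfM mulrA divff ?mul1r//.
by rewrite normr_eq0.
Qed.

Lemma normal_prob_affine (m s : R) (V : set R) : s != 0 -> measurable V ->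
  normal_prob m s V = normal_prob 0 1 [set x | V (s * x + m)].
Proof.
move=> s0 mV.
have mphi : measurable_fun setT (fun x : R => s * x + m).
  by apply: measurable_funD => //; apply: measurable_funM.
have mV' : measurable ((fun x : R => s * x + m) @^-1` V).
  by rewrite -[X in measurable X]setTI; exact: mphi.
rewrite /normal_prob [LHS]integral_mkcond [RHS]integral_mkcond.
rewrite [LHS](@ge0_integral_affine _ s m)//.
- rewrite -ge0_integralZl//.
  + apply: eq_integral => x _; rewrite !patchE.
    have -> : (x \in [set y | V (s * y + m)]) = (s * x + m \in V).
      by apply/idP/idP; rewrite !inE.
    case: ifPn => _; last by rewrite mule0.
    by rewrite -EFinM normal_pdf_affine.
  + apply: (measurableT_comp _ mphi).
    apply/(measurable_restrictT _ _).1 => //.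
    by apply/measurable_funTS/measurable_EFinP; exact: measurable_normal_pdf.
  + by move=> x _; rewrite patchE; case: ifP => // _; rewrite lee_fin normal_pdf_ge0.
- apply/(measurable_restrictT _ _).1 => //.
  by apply/measurable_funTS/measurable_EFinP; exact: measurable_normal_pdf.
- by move=> x; rewrite patchE; case: ifP => // _; rewrite lee_fin normal_pdf_ge0.
Qed.

End normal.

(** * Taylor bounds for sine and cosine *)

Section trig_bounds.
Context {R : realType}.
Implicit Types x y : R.

(** The four bounds that follow are integrals of one another, starting from
    [cos <= 1]; this is the integration step. *)
Lemma ge0_is_derive_ge0 (f df : R -> R) :
  (forall x, is_derive x 1 f (df x)) -> (forall x, 0 <= x -> 0 <= df x) ->
  f 0 = 0 -> forall x, 0 <= x -> 0 <= f x.
Proof.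
move=> fdf df0 f0 x x0; rewrite -f0.
apply: (@ger0_derive1_le_cc _ f 0 x); rewrite ?in_itv/= ?lexx ?x0//.
- move=> y; rewrite in_itv/= => /andP[y0 _].
  by rewrite derive1E derive_val df0// ltW.
- apply: derivable_within_continuous => y _.
  by apply: ex_derive.
Qed.

Lemma sin_le_id x : 0 <= x -> sin x <= x.
Proof.
move=> x0; rewrite -subr_ge0.
apply: (@ge0_is_derive_ge0 (fun x => x - sin x) (fun x => 1 - cos x)) => //.
by rewrite sin0 subr0.
Qed.

Lemma cos_ge_quadratic x : 1 - x ^+ 2 / 2 <= cos x.
Proof.
wlog x0 : x / 0 <= x => [wlg|].
  by have [/wlg//|x0] := leP 0 x; rewrite -cosN -sqrrN wlg// oppr_ge0 ltW.
rewrite -subr_ge0.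
apply: (@ge0_is_derive_ge0 (fun x => cos x - (1 - x ^+ 2 / 2))
  (fun x => x - sin x)) => //.
- move=> y; apply: is_derive_eq.
  by rewrite !scaler0 /GRing.scale/=; field.
- by move=> y y0; rewrite subr_ge0 sin_le_id.
- by rewrite cos0 expr0n/= mul0r subr0 subrr.
Qed.

Lemma sin_ge_cubic x : 0 <= x -> x - x ^+ 3 / 6 <= sin x.
Proof.
move=> x0; rewrite -subr_ge0.
apply: (@ge0_is_derive_ge0 (fun x => sin x - (x - x ^+ 3 / 6))
  (fun x => cos x - (1 - x ^+ 2 / 2))) => //.
- move=> y; apply: is_derive_eq.
  by rewrite !scaler0 /GRing.scale/=; field.
- by move=> y y0; rewrite subr_ge0 cos_ge_quadratic.
- by rewrite sin0 expr0n/= mul0r !subr0.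
Qed.

Lemma cos_le_quartic x : cos x <= 1 - x ^+ 2 / 2 + x ^+ 4 / 24.
Proof.
wlog x0 : x / 0 <= x => [wlg|].
  have [/wlg//|x0] := leP 0 x.
  by rewrite -cosN -sqrrN (_ : x ^+ 4 = (- x) ^+ 4) ?wlg ?oppr_ge0 ?ltW//; ring.
rewrite -subr_ge0.
apply: (@ge0_is_derive_ge0 (fun x => 1 - x ^+ 2 / 2 + x ^+ 4 / 24 - cos x)
  (fun x => sin x - (x - x ^+ 3 / 6))) => //.
- move=> y; apply: is_derive_eq.
  by rewrite !scaler0 /GRing.scale/=; field.
- by move=> y y0; rewrite subr_ge0 sin_ge_cubic.
- by rewrite cos0 !expr0n/= !mul0r subr0 addr0 subrr.
Qed.

Lemma cos_taylor2 x : `|cos x - 1 + x ^+ 2 / 2| <= x ^+ 4 / 24.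
Proof.
have := cos_ge_quadratic x; have := cos_le_quartic x.
have : 0 <= x ^+ 4 by rewrite exprn_even_ge0.
by move=> h1 h2 h3; rewrite ler_norml; apply/andP; split; lra.
Qed.

Lemma sin_taylor1 x : `|sin x - x| <= `|x| ^+ 3 / 6.
Proof.
wlog x0 : x / 0 <= x => [wlg|].
  have [/wlg//|x0] := leP 0 x.
  by rewrite -normrN opprD -sinN -(normrN x) wlg// oppr_ge0 ltW.
have h1 := sin_le_id x0; have h2 := sin_ge_cubic x0.
by rewrite (ger0_norm x0) ler_norml; apply/andP; split; lra.
Qed.

Lemma abs_sin_le x : `|sin x| <= `|x|.
Proof.
wlog x0 : x / 0 <= x => [wlg|].
  have [/wlg//|x0] := leP 0 x.
  by rewrite -normrN -sinN -(normrN x) wlg// oppr_ge0 ltW.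
have [x1|x1] := leP x 1; last first.
  rewrite (ger0_norm x0); apply: le_trans (ltW x1).
  by rewrite ler_norml sin_geN1 sin_le1.
have h1 := sin_le_id x0; have h2 := sin_ge_cubic x0.
have h3 : x ^+ 3 <= x.
  by rewrite -[leRHS]mulr1 exprS ler_pM ?exprn_ge0// exprn_ile1.
by rewrite (ger0_norm x0) ler_norml h1; apply/andP; split; lra.
Qed.

Lemma cos_lip x y : `|cos (x + y) - cos x| <= `|y|.
Proof.
have -> : cos (x + y) - cos x = - 2 * (sin (x + y / 2) * sin (y / 2)).
  have -> : x + y = (x + y / 2) + y / 2 by field.
  have {2}-> : x = (x + y / 2) - y / 2 by field.
  by rewrite cosD cosB; ring.
rewrite !normrM normrN (ger0_norm (ler0n _ 2)).
have h1 : `|sin (x + y / 2)| <= 1 by rewrite ler_norml sin_geN1 sin_le1.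
have h2 := abs_sin_le (y / 2).
have h3 : `|y / 2| = `|y| / 2 by rewrite normrM (ger0_norm (_ : 0 <= 2^-1)).
have h4 : `|sin (x + y / 2)| * `|sin (y / 2)| <= 1 * `|y / 2| by rewrite ler_pM.
by rewrite h3 in h4; lra.
Qed.

(** Expanding [cos (x + y)] by the addition formula moves the error of the
    expansions at [0] to the point [x]. *)
Lemma cos_taylor_at x y :
  `|cos (x + y) - (cos x - y * sin x - y ^+ 2 / 2 * cos x)|
  <= `|y| ^+ 3 + y ^+ 4.
Proof.
have -> : cos (x + y) - (cos x - y * sin x - y ^+ 2 / 2 * cos x) =
  cos x * (cos y - 1 + y ^+ 2 / 2) - sin x * (sin y - y).
  by rewrite cosD; ring.
have h1 := cos_taylor2 y; have h2 := sin_taylor1 y.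
have c1 : `|cos x| <= 1 by rewrite ler_norml cos_geN1 cos_le1.
have s1 : `|sin x| <= 1 by rewrite ler_norml sin_geN1 sin_le1.
have y3 : 0 <= `|y| ^+ 3 by rewrite exprn_ge0.
have y4 : 0 <= y ^+ 4 by rewrite exprn_even_ge0.
apply: (le_trans (ler_normB _ _)); rewrite !normrM.
have e1 : `|cos x| * `|cos y - 1 + y ^+ 2 / 2| <= 1 * (y ^+ 4 / 24).
  by rewrite ler_pM.
have e2 : `|sin x| * `|sin y - y| <= 1 * (`|y| ^+ 3 / 6) by rewrite ler_pM.
by lra.
Qed.

End trig_bounds.

(** * Sums of independent normal variables *)

Section normal_law.
Context {R : realType}.
Local Notation mu := (@lebesgue_measure R).
Local Notation std := (@normal_prob R 0 1).

(** Every real [s] is allowed: at [s = 0] both sides are the Dirac mass, and the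
    density of a normal law depends on its deviation only through the square. *)
Lemma normal_law_sqr (s : R) (V : set R) : measurable V ->
  normal_law 0 (s ^+ 2) V = std [set x | V (s * x)].
Proof.
move=> mV; rewrite /normal_law sqrf_eq0 sqrtr_sqr.
have [->|s0] := eqVneq s 0.
  rewrite /dirac indicE.
  under [in RHS]eq_set do rewrite mul0r.
  have [V0|V0] := boolP (0 \in V).
    rewrite (_ : [set _ | _] = setT); last first.
      by apply/seteqP; split => // x _; rewrite inE in V0.
    by rewrite probability_setT.
  rewrite (_ : [set _ | _] = set0) ?measure0//.
  by apply/seteqP; split => // x /= Vx; rewrite notin_setE in V0.
have -> : normal_prob 0 `|s| V = normal_prob 0 s V.
  rewrite /normal_prob; apply: eq_integral => x _; congr EFin.
  by rewrite !normal_pdfE ?normr_eq0// /normal_peak /normal_fun -normrX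
    (ger0_norm (sqr_ge0 s)).
rewrite normal_prob_affine//; congr (std _).
by apply/seteqP; split => x /=; rewrite addr0.
Qed.

(** Completing the square: for independent standard normal [X] and [Y], the
    joint density of [X] and [Z = a X + c Y] is also the density of [Z] times
    the conditional density of [X] given [Z]. *)
Lemma normal_pdf_mul (a c x z : R) : c != 0 ->
  normal_pdf (a * x) c z * normal_pdf 0 1 x =
  normal_pdf 0 (Num.sqrt (a ^+ 2 + c ^+ 2)) z *
  normal_pdf (a * z / (a ^+ 2 + c ^+ 2)) (c / Num.sqrt (a ^+ 2 + c ^+ 2)) x.
Proof.
move=> c0.
have q0 : 0 < a ^+ 2 + c ^+ 2.
  by rewrite ltr_wpDl ?sqr_ge0// exprn_even_gt0.
have s0 : Num.sqrt (a ^+ 2 + c ^+ 2) != 0 by rewrite gt_eqF// sqrtr_gt0.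
rewrite !normal_pdfE ?oner_eq0 ?mulf_neq0 ?invr_eq0//.
rewrite /normal_peak /normal_fun mulrACA -expRD [RHS]mulrACA -expRD.
rewrite !exprMn exprVn sqr_sqrtr ?(ltW q0)// expr1n; congr (_ * expR _).
  rewrite -[LHS]invfM -[RHS]invfM; congr (_^-1).
  rewrite -[LHS]sqrtrM; last by rewrite mulrn_wge0// mulr_ge0 ?sqr_ge0 ?pi_ge0.
  rewrite -[RHS]sqrtrM; last by rewrite mulrn_wge0// mulr_ge0 ?pi_ge0// ltW.
  by congr Num.sqrt; field; rewrite gt_eqF.
by field; rewrite c0 gt_eqF.
Qed.

(** By Tonelli one may integrate in [X] first; the conditional density of
    [normal_pdf_mul] then has total mass [1] and the density of the sum is what
    remains. *)
Lemma std_convolution (a c : R) (V : set R) : measurable V ->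
  (\int[std]_x std [set y | V (a * x + c * y)%R] =
  normal_law 0 (a ^+ 2 + c ^+ 2)%R V)%E.
Proof.
move=> mV.
have [->|c0] := eqVneq c 0.
  rewrite expr0n addr0 normal_law_sqr//.
  have mV' : measurable [set x | V (a * x)].
    rewrite -[X in measurable X]setTI.
    by apply: (measurable_funM (measurable_cst a) (@measurable_id _ _ setT)).
  rewrite -[in RHS](setIT [set x | V (a * x)]) -integral_indic//.
  apply: eq_integral => x _; rewrite indicE.
  under eq_set do rewrite mul0r addr0.
  have [Vx|Vx] := boolP (x \in _).
    rewrite (_ : [set _ | _] = setT) ?probability_setT//.
    by apply/seteqP; split => // y _; rewrite inE in Vx.
  rewrite (_ : [set _ | _] = set0) ?measure0//.
  by apply/seteqP; split => // y /= Vy; rewrite notin_setE in Vx.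
have q0 : 0 < a ^+ 2 + c ^+ 2.
  by rewrite ltr_wpDl ?sqr_ge0// exprn_even_gt0.
have s0 : Num.sqrt (a ^+ 2 + c ^+ 2) != 0 by rewrite gt_eqF// sqrtr_gt0.
rewrite /normal_law gt_eqF//.
pose F (p : measurableTypeR R * measurableTypeR R) : \bar R :=
  ((\1_V p.2 * normal_pdf (a * p.1)%R c p.2)%:E)%E.
have F0 p : (0 <= F p)%E by rewrite lee_fin mulr_ge0// normal_pdf_ge0.
have mF : measurable_fun setT F.
  apply/measurable_EFinP; apply: measurable_funM.
    exact: measurableT_comp.
  rewrite (_ : (fun p => _) = (fun p : measurableTypeR R * measurableTypeR R =>
     normal_pdf 0 c (p.2 - a * p.1))); last first.
    by apply/funext => p; rewrite !normal_pdfE// /normal_fun subr0.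
  apply: (measurableT_comp (measurable_normal_pdf _ _)).
  by apply: measurable_funB => //; apply: measurable_funM.
have stepx x : std [set y | V (a * x + c * y)] = (\int[mu]_z F (x, z))%E.
  transitivity (normal_prob (a * x) c V).
    rewrite [RHS]normal_prob_affine//; congr (std _).
    by apply/seteqP; split => y /=; rewrite addrC.
  rewrite /normal_prob integral_mkcond; apply: eq_integral => z _.
  by rewrite patchE /F /= indicE; case: ifP => _; rewrite ?mul1r ?mul0r.
under eq_integral do rewrite stepx.
rewrite ge0_integral_normal_prob//; first last.
- by move=> x; apply: integral_ge0.
- exact: (measurable_fun_fubini_tonelli_F F).
pose G (p : measurableTypeR R * measurableTypeR R) : \bar R :=
  (F p * (normal_pdf 0 1 p.1)%:E)%E.
have G0 p : (0 <= G p)%E by rewrite mule_ge0// lee_fin normal_pdf_ge0.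
have mG : measurable_fun setT G.
  apply: emeasurable_funM => //; apply/measurable_EFinP.
  exact: (measurableT_comp (measurable_normal_pdf _ _)).
transitivity (\int[mu]_x \int[mu]_z G (x, z))%E.
  apply: eq_integral => x _.
  rewrite -ge0_integralZr//; last by rewrite lee_fin normal_pdf_ge0.
  exact: (measurableT_comp mF).
rewrite (fubini_tonelli G)// /normal_prob [RHS]integral_mkcond.
apply: eq_integral => z _; rewrite patchE.
transitivity (\int[mu]_x
   ((\1_V z * normal_pdf 0 (Num.sqrt (a ^+ 2 + c ^+ 2)) z)%:E *
   (normal_pdf (a * z / (a ^+ 2 + c ^+ 2))
     (c / Num.sqrt (a ^+ 2 + c ^+ 2)) x)%:E))%E.
  apply: eq_integral => x _; rewrite /G /F /= -!EFinM.
  congr EFin; apply: etrans (esym (mulrA _ _ _)) (etrans _ (mulrA _ _ _)).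
  by congr (_ * _); exact: normal_pdf_mul.
rewrite ge0_integralZl//.
- rewrite integral_normal_pdf mule1 indicE.
  by case: ifP => _; rewrite ?mul1r ?mul0r.
- by apply/measurable_EFinP; exact: measurable_normal_pdf.
- by move=> x _; rewrite lee_fin normal_pdf_ge0.
- by rewrite lee_fin mulr_ge0 ?normal_pdf_ge0.
Qed.

End normal_law.

(** * Integration on probability spaces; moments of the standard normal law *)

Section bounded_integrals.
Context d (T : measurableType d) (R : realType).

Lemma bounded_integrable (P : probability T R) (f : T -> R) (M : R) :
  measurable_fun setT f -> (forall x, `|f x| <= M) ->
  P.-integrable setT (EFin \o f).
Proof.
move=> mf fM; apply: (@le_integrable _ _ _ _ _ _ _ (EFin \o cst M)) => //.
- exact/measurable_EFinP.
- by move=> x _ /=; rewrite lee_fin (le_trans (fM x))// ler_norm.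
- exact: finite_measure_integrable_cst.
Qed.

Lemma EFin_Rintegral (P : probability T R) (f : T -> R) :
  P.-integrable setT (EFin \o f) ->
  (\int[P]_x (f x)%:E)%E = (\int[P]_x f x)%:E.
Proof. by move=> fi; rewrite /Rintegral fineK//; exact: integrable_fin_num. Qed.

Lemma integrable_finsum (P : probability T R) (I : finType) (F : I -> T -> R) :
  (forall i, P.-integrable setT (EFin \o F i)) ->
  P.-integrable setT (EFin \o (fun w => \sum_i F i w)).
Proof.
move=> iF; rewrite (_ : EFin \o _ = (fun w => \sum_i (F i w)%:E)%E).
  by apply: integrable_sum => // i _; exact: iF.
by apply/funext => w /=; rewrite sumEFin.
Qed.

Lemma Rintegral_finsum (P : probability T R) (I : finType) (F : I -> T -> R) :
  (forall i, P.-integrable setT (EFin \o F i)) ->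
  \int[P]_w (\sum_i F i w) = \sum_i \int[P]_w F i w.
Proof.
move=> iF; apply: EFin_inj; rewrite -sumEFin.
rewrite -(EFin_Rintegral (integrable_finsum iF)).
rewrite [LHS](_ : _ = (\int[P]_w (\sum_i (F i w)%:E))%E); last first.
  by apply: eq_integral => w _; rewrite sumEFin.
rewrite integral_sum//; apply: eq_bigr => i _.
exact: (EFin_Rintegral (iF i)).
Qed.

Lemma Rintegral_probability_cst (P : probability T R) (r : R) :
  \int[P]_x (cst r x) = r.
Proof.
rewrite Rintegral_cst//.
apply: etrans (mulr1 r).
exact: (congr1 (fun t => r * fine t) (probability_setT P)).
Qed.

(** Both integrals are the integral of [f] against the common image measure. *)
Lemma Rintegral_eq_law d' (T' : measurableType d') (P : probability T R)
    (P' : probability T' R) (X : T -> R) (X' : T' -> R) (f : R -> R) :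
  measurable_fun setT X -> measurable_fun setT X' -> measurable_fun setT f ->
  (forall V, measurable V -> P (X @^-1` V) = P' (X' @^-1` V)) ->
  P.-integrable setT (EFin \o (f \o X)) ->
  P'.-integrable setT (EFin \o (f \o X')) ->
  \int[P]_x f (X x) = \int[P']_x f (X' x).
Proof.
move=> mX mX' mf XX' fX fX'; congr fine.
have mf' : measurable_fun setT (EFin \o f) by exact/measurable_EFinP.
transitivity (\int[pushforward P X]_y (EFin \o f) y)%E.
  by rewrite integral_pushforward.
transitivity (\int[pushforward P' X']_y (EFin \o f) y)%E; last first.
  by rewrite integral_pushforward.
by apply: eq_measure_integral => V mV _; exact: XX'.
Qed.

End bounded_integrals.

Section std_moments.
Context {R : realType}.
Local Notation std := (@normal_prob R 0 1).

(** Multiplying a centred normal density by [exp (h x ^ 2)] rescales it, the new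
    deviation [s] being given by [h = (1 - s ^- 2) / 2]. *)
Lemma normal_pdf_tilt (s x : R) : 0 < s ->
  expR ((1 - s ^- 2) / 2 * x ^+ 2) * normal_pdf 0 1 x = s * normal_pdf 0 s x.
Proof.
move=> s0; rewrite !normal_pdfE ?oner_eq0 ?gt_eqF//=.
have -> : normal_peak s = s^-1 * normal_peak 1.
  rewrite /normal_peak expr1n mul1r -mulrnAr sqrtrM ?sqr_ge0// sqrtr_sqr.
  by rewrite gtr0_norm// invfM.
rewrite !mulrA divff ?gt_eqF// mul1r mulrAC [RHS]mulrC; congr (_ * _).
rewrite /normal_fun -expRD; congr expR.
by rewrite expr1n; field; rewrite gt_eqF.
Qed.

Lemma std_exp_sqr (s : R) : 0 < s ->
  (\int[std]_x (expR ((1 - s ^- 2) / 2 * x ^+ 2))%:E = s%:E)%E.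
Proof.
move=> s0; rewrite ge0_integral_normal_prob; first last.
- by move=> x; rewrite lee_fin expR_ge0.
- apply/measurable_EFinP/measurableT_comp => //.
  by apply: measurable_funM => //; exact: measurable_funX.
under eq_integral do rewrite -EFinM normal_pdf_tilt// EFinM.
rewrite ge0_integralZl//=; first by rewrite integral_normal_pdf mule1.
- by apply/measurable_EFinP; exact: measurable_normal_pdf.
- by move=> x _; rewrite lee_fin normal_pdf_ge0.
- by rewrite lee_fin ltW.
Qed.

Lemma integrable_std_exp_sqr (s : R) : 0 < s ->
  std.-integrable setT (EFin \o (fun x => expR ((1 - s ^- 2) / 2 * x ^+ 2))).
Proof.
move=> s0; apply/integrableP; split.
  apply/measurable_EFinP/measurableT_comp => //.
  by apply: measurable_funM => //; exact: measurable_funX.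
under eq_integral do rewrite /= ger0_norm ?expR_ge0//.
by rewrite std_exp_sqr// ltry.
Qed.

Lemma integrable_std_pow4 : std.-integrable setT (EFin \o (fun x : R => x ^+ 4)).
Proof.
have s0 : 0 < Num.sqrt 2 :> R by rewrite sqrtr_gt0.
(* For s = sqrt 2 the tilt is exp (x ^ 2 / 4), which is at least x ^ 4 / 32. *)
apply: (@le_integrable _ _ _ _ _ _ _ (EFin \o
    (fun x : measurableTypeR R =>
       32 * expR ((1 - Num.sqrt 2 ^- 2) / 2 * x ^+ 2)))) => //.
- by apply/measurable_EFinP; exact: measurable_funX.
- move=> x _ /=; rewrite lee_fin sqr_sqrtr// !ger0_norm ?exprn_even_ge0//.
  have y0 : 0 <= (1 - 2^-1) / 2 * x ^+ 2 :> R by rewrite mulr_ge0 ?sqr_ge0//; lra.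
  have := @expR_ge1Dxn R _ 1 y0; rewrite (_ : 2`! = 2)// => h.
  apply: (@le_trans _ _ (32 * (1 + ((1 - 2^-1) / 2 * x ^+ 2) ^+ 2 / 2))).
    by rewrite -[leLHS]add0r (_ : 32 * _ = 32 + x ^+ 4); [lra|field].
  by rewrite ler_pM2l.
- exact: (@integrableZl _ _ _ _ _ measurableT 32 _ (integrable_std_exp_sqr s0)).
Qed.

Lemma integrable_std_sqr : std.-integrable setT (EFin \o (fun x : R => x ^+ 2)).
Proof.
apply: (@le_integrable _ _ _ _ _ _ _
  (EFin \o (fun x : measurableTypeR R => x ^+ 4 + cst 1 x))) => //.
- by apply/measurable_EFinP; exact: measurable_funX.
- move=> x _ /=; rewrite lee_fin !ger0_norm ?exprn_even_ge0//.
    have : 0 <= (x ^+ 2 - 1 / 2) ^+ 2 by exact: sqr_ge0.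
    by rewrite (_ : (_ - _) ^+ 2 = x ^+ 4 - x ^+ 2 + 1 / 4); [lra|field].
  by rewrite addr_ge0// exprn_even_ge0.
- have i1 : std.-integrable setT (EFin \o cst (1 : R)).
    exact: finite_measure_integrable_cst.
  exact: (@integrableD _ _ _ _ _ measurableT _ _ integrable_std_pow4 i1).
Qed.

(** The inequality [1 + h x ^ 2 <= exp (h x ^ 2)] integrates to
    [1 + (1 - s ^- 2) / 2 * m <= s].  Both sides have the same value at [s = 1],
    so comparing slopes for [s] slightly above and slightly below [1] pins [m]
    from both sides. *)
Lemma std_second_moment : \int[std]_x (x ^+ 2) = 1.
Proof.
set m := \int[std]_x (x ^+ 2).
have key (s : R) : 0 < s -> 1 + (1 - s ^- 2) / 2 * m <= s.
  move=> s0.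
  have i2 := integrable_std_sqr.
  have iZ : std.-integrable setT
      (EFin \o (fun x : R => (1 - s ^- 2) / 2 * x ^+ 2)).
    exact: (@integrableZl _ _ _ _ _ measurableT ((1 - s ^- 2) / 2) _ i2).
  have i1 : std.-integrable setT (EFin \o cst (1 : R)).
    exact: finite_measure_integrable_cst.
  have := @le_Rintegral _ _ _ std setT
    (fun x => cst 1 x + (1 - s ^- 2) / 2 * x ^+ 2)
    (fun x => expR ((1 - s ^- 2) / 2 * x ^+ 2)) measurableT.
  rewrite RintegralD// Rintegral_probability_cst RintegralZl//.
  rewrite [X in _ -> _ -> _ -> _ <= X](_ : _ = s); last first.
    by rewrite /Rintegral std_exp_sqr.
  apply.
  - exact: (@integrableD _ _ _ _ _ measurableT _ _ i1 iZ).
  - exact: integrable_std_exp_sqr.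
  - by move=> x _; exact: expR_ge1Dx.
apply/eqP; rewrite eq_le; apply/andP; split; apply/ler_addgt0Pl => e e0.
- have h0 : 0 < 1 + e / 2 by lra.
  have := key _ h0.
  rewrite (_ : 1 + (1 - (1 + e / 2) ^- 2) / 2 * m =
    1 + e / 2 * ((2 + e / 2) / (2 * (1 + e / 2) ^+ 2) * m)); last by field; lra.
  rewrite lerD2l -[X in _ <= X]mulr1 ler_pM2l ?divr_gt0//.
  rewrite mulrC mulrA ler_pdivrMr ?mulr_gt0 ?exprn_gt0// mul1r => h.
  have : m * (2 + e / 2) <= (e + 1) * (2 + e / 2).
    by apply: (le_trans h); nra.
  by rewrite ler_pM2r//; lra.
- set u := Num.min e 1 / 2.
  have u0 : 0 < u by rewrite divr_gt0// lt_min e0 ltr01.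
  have ue : u <= e / 2 by rewrite ler_pM2r// ge_min lexx.
  have u1 : u <= 1 / 2 by rewrite ler_pM2r// ge_min lexx orbT.
  have h0 : 0 < 1 - u by lra.
  have := key _ h0.
  rewrite (_ : 1 + (1 - (1 - u) ^- 2) / 2 * m =
    1 - u * ((2 - u) / (2 * (1 - u) ^+ 2) * m)); last by field; lra.
  rewrite lerD2l lerN2 -[X in X <= _]mulr1 ler_pM2l//.
  rewrite mulrC mulrA ler_pdivlMr ?mulr_gt0 ?exprn_gt0// mul1r => h.
  have : (1 - 2 * u) * (2 - u) <= m * (2 - u).
    by apply: le_trans h; nra.
  by rewrite ler_pM2r; lra.
Qed.

End std_moments.

(** * The characteristic function of the normal law *)

Section gauss_char.
Context {R : realType}.
Local Notation std := (@normal_prob R 0 1).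

Lemma integrable_eq_law d d' (T : measurableType d) (T' : measurableType d')
    (P : probability T R) (P' : probability T' R) (X : T -> R) (X' : T' -> R)
    (f : R -> R) :
  measurable_fun setT X -> measurable_fun setT X' -> measurable_fun setT f ->
  (forall V, measurable V -> P (X @^-1` V) = P' (X' @^-1` V)) ->
  P'.-integrable setT (EFin \o (f \o X')) ->
  P.-integrable setT (EFin \o (f \o X)).
Proof.
move=> mX mX' mf XX' /integrableP[_ fX'].
have mf' : measurable_fun setT (fun x => `|(f x)%:E|%E).
  by apply: measurableT_comp => //; exact/measurable_EFinP.
apply/integrableP; split; first exact/measurable_EFinP/measurableT_comp.
apply: le_lt_trans fX'.
rewrite -(@ge0_integral_pushforward _ _ _ _ _ X mX P setT (fun x => `|(f x)%:E|)%E)//.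
rewrite -(@ge0_integral_pushforward _ _ _ _ _ X' mX' P' setT (fun x => `|(f x)%:E|)%E)//.
by rewrite (eq_measure_integral (pushforward P' X'))// => V mV _; exact: XX'.
Qed.

(** The characteristic function at [1] of the centred normal law of variance
    [v]; it is real because the law is symmetric.  It enters the proof through
    [gauss_charD] and [gauss_char_expansion]. *)
Definition gauss_char (v : R) : R := \int[std]_x cos (Num.sqrt v * x).

Lemma measurable_cos_affine (a b : R) :
  measurable_fun setT (fun x : R => cos (a + b * x)).
Proof.
apply: (measurableT_comp (continuous_measurable_fun (@continuous_cos R))).
by apply: measurable_funD => //; apply: measurable_funM.
Qed.

Lemma measurable_sin_affine (a b : R) :
  measurable_fun setT (fun x : R => sin (a + b * x)).
Proof.
apply: (measurableT_comp (continuous_measurable_fun (@continuous_sin R))).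
by apply: measurable_funD => //; apply: measurable_funM.
Qed.

Lemma abs_cos_le1 (x : R) : `|cos x| <= 1.
Proof. by rewrite ler_norml cos_geN1 cos_le1. Qed.

Lemma abs_sin_le1 (x : R) : `|sin x| <= 1.
Proof. by rewrite ler_norml sin_geN1 sin_le1. Qed.

Lemma integrable_cos_affine (P : probability (measurableTypeR R) R) (a b : R) :
  P.-integrable setT (EFin \o (fun x : R => cos (a + b * x))).
Proof.
by apply: (bounded_integrable P (measurable_cos_affine a b)) => x;
  exact: abs_cos_le1.
Qed.

Lemma integrable_sin_affine (P : probability (measurableTypeR R) R) (a b : R) :
  P.-integrable setT (EFin \o (fun x : R => sin (a + b * x))).
Proof.
by apply: (bounded_integrable P (measurable_sin_affine a b)) => x;
  exact: abs_sin_le1.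
Qed.

Lemma gauss_charE (v : R) :
  gauss_char v = \int[std]_x cos (0 + Num.sqrt v * x).
Proof. by apply: eq_Rintegral => x _; rewrite add0r. Qed.

Lemma gauss_char_le1 (v : R) : `|gauss_char v| <= 1.
Proof.
rewrite gauss_charE.
apply: (le_trans (le_normr_Rintegral measurableT (integrable_cos_affine _ _ _))).
rewrite -[leRHS](Rintegral_probability_cst std).
apply: le_Rintegral => //.
- exact: (integrable_norm (integrable_cos_affine _ _ _)).
- exact: finite_measure_integrable_cst.
- by move=> x _; exact: abs_cos_le1.
Qed.

(** The fourth-order Taylor bound of the cosine, integrated: the second moment
    of the standard normal law is [1] and its fourth moment is finite. *)
Lemma gauss_char_expansion : exists2 K : R, 0 <= K &
  forall v, 0 <= v -> `|gauss_char v - (1 - v / 2)| <= K * v ^+ 2.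
Proof.
exists ((\int[std]_x (x ^+ 4)) / 24) => [|v v0].
  rewrite divr_ge0// Rintegral_ge0// => x _.
  by rewrite exprn_even_ge0.
set s := Num.sqrt v; have s2 : s ^+ 2 = v by rewrite sqr_sqrtr.
have i1 : std.-integrable setT (EFin \o cst (1 : R)).
  exact: finite_measure_integrable_cst.
have ic := integrable_cos_affine std 0 s.
have i2 : std.-integrable setT (EFin \o (fun x : R => v / 2 * x ^+ 2)).
  exact: (@integrableZl _ _ _ _ _ measurableT (v / 2) _ integrable_std_sqr).
have i4 : std.-integrable setT (EFin \o (fun x : R => v ^+ 2 / 24 * x ^+ 4)).
  exact: (@integrableZl _ _ _ _ _ measurableT (v ^+ 2 / 24) _ integrable_std_pow4).
have i12 : std.-integrable setT (EFin \o (fun x : R => cst 1 x - v / 2 * x ^+ 2)).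
  exact: (@integrableB _ _ _ _ _ measurableT _ _ i1 i2).
have ic12 : std.-integrable setT
    (EFin \o (fun x : R => cos (0 + s * x) - (cst 1 x - v / 2 * x ^+ 2))).
  exact: (@integrableB _ _ _ _ _ measurableT _ _ ic i12).
have -> : gauss_char v - (1 - v / 2) =
    \int[std]_x (cos (0 + s * x) - (cst 1 x - v / 2 * x ^+ 2)).
  rewrite RintegralB// RintegralB// RintegralZl//; last exact: integrable_std_sqr.
  by rewrite Rintegral_probability_cst std_second_moment mulr1 gauss_charE.
have -> : (\int[std]_x (x ^+ 4)) / 24 * v ^+ 2 =
    \int[std]_x (v ^+ 2 / 24 * x ^+ 4).
  by rewrite RintegralZl//; [ring|exact: integrable_std_pow4].
apply: (le_trans (le_normr_Rintegral measurableT ic12)).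
apply: le_Rintegral => //; first exact: (integrable_norm ic12).
move=> x _ /=; have := cos_taylor2 (s * x).
rewrite add0r !exprMn s2 (_ : s ^+ 4 = v ^+ 2); last by rewrite -s2 -exprM.
rewrite (_ : v ^+ 2 * x ^+ 4 / 24 = v ^+ 2 / 24 * x ^+ 4); last by ring.
by rewrite (_ : _ - (1 - _) = cos (s * x) - 1 + v * x ^+ 2 / 2)//; ring.
Qed.

Lemma std_sym (V : set R) : measurable V -> std V = std [set x | V (- x)].
Proof.
move=> mV; have := normal_law_sqr (-1) mV; rewrite sqrrN.
rewrite (normal_law_sqr 1 mV) => e.
transitivity (std [set x | V (1 * x)]).
  by congr (std _); apply/seteqP; split => x /=; rewrite mul1r.
rewrite e; congr (std _).
by apply/seteqP; split => x /=; rewrite mulN1r.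
Qed.

Lemma std_sin_eq0 (b : R) : \int[std]_x sin (0 + b * x) = 0.
Proof.
have ib := integrable_sin_affine std 0 b.
have ib' := integrable_sin_affine std 0 (- b).
have mN : measurable_fun setT (fun x : R => - x) by exact: measurable_funN.
have h : \int[std]_x sin (0 + b * x) = \int[std]_x sin (0 + b * (- x)).
  apply: (@Rintegral_eq_law _ _ _ _ _ std std id (fun x : R => - x)
    (fun x => sin (0 + b * x))) => //.
  - exact: measurable_sin_affine.
  - by move=> V mV; exact: std_sym.
  - apply: eq_integrable ib' => // x _ /=.
    by rewrite mulrN mulNr.
have : \int[std]_x sin (0 + b * (- x)) = -1 * \int[std]_x sin (0 + b * x).
  rewrite -RintegralZl//; apply: eq_Rintegral => x _.
  by rewrite !add0r mulrN sinN mulN1r.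
rewrite -h mulN1r => /eqP; rewrite -addr_eq0 -mulr2n mulrn_eq0.
by move/eqP.
Qed.

Lemma std_cos_phase (a b : R) :
  \int[std]_x cos (a + b * x) = cos a * \int[std]_x cos (0 + b * x).
Proof.
have ic := integrable_cos_affine std 0 b.
have is_ := integrable_sin_affine std 0 b.
have ic' : std.-integrable setT (EFin \o (fun x : R => cos a * cos (0 + b * x))).
  exact: (@integrableZl _ _ _ _ _ measurableT (cos a) _ ic).
have is' : std.-integrable setT (EFin \o (fun x : R => sin a * sin (0 + b * x))).
  exact: (@integrableZl _ _ _ _ _ measurableT (sin a) _ is_).
transitivity (\int[std]_x (cos a * cos (0 + b * x) - sin a * sin (0 + b * x))).
  by apply: eq_Rintegral => x _; rewrite add0r cosD.
by rewrite RintegralB// !RintegralZl// std_sin_eq0 mulr0 subr0.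
Qed.

(** A normal variable of variance [v + w] is a sum of two independent ones, so
    its characteristic function is computed on the product space; the sine term
    of the addition formula vanishes by symmetry. *)
Lemma gauss_charD (v w : R) : 0 <= v -> 0 <= w ->
  gauss_char (v + w) = gauss_char v * gauss_char w.
Proof.
move=> v0 w0; pose a := Num.sqrt v; pose b := Num.sqrt w.
have [a2 b2] : a ^+ 2 = v /\ b ^+ 2 = w by rewrite !sqr_sqrtr.
pose X' (p : measurableTypeR R * measurableTypeR R) : R := a * p.1 + b * p.2.
have mX' : measurable_fun setT X'.
  by apply: measurable_funD => //; apply: measurable_funM.
have mc := measurable_cos_affine 0 1.
have mX : measurable_fun setT (fun x : R => Num.sqrt (v + w) * x).
  by apply: measurable_funM.
have icX' : (std \x std)%E.-integrable setT
    (EFin \o ((fun x : R => cos (0 + 1 * x)) \o X')).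
  apply: (@bounded_integrable _ _ _ _ _ 1) => [|x]; last exact: abs_cos_le1.
  exact: measurableT_comp.
transitivity (\int[(std \x std)%E]_p cos (0 + 1 * X' p)).
  transitivity (\int[std]_x (cos (0 + 1 * (Num.sqrt (v + w) * x)))).
    by apply: eq_Rintegral => x _; rewrite add0r mul1r.
  apply: (@Rintegral_eq_law _ _ _ _ _ std (std \x std)%E
    (fun x : R => Num.sqrt (v + w) * x) X' (fun x => cos (0 + 1 * x))) => //.
  - move=> V mV.
    apply: etrans (esym (normal_law_sqr (Num.sqrt (v + w)) mV)) _.
    rewrite (sqr_sqrtr (addr_ge0 v0 w0)).
    have -> : v + w = a ^+ 2 + b ^+ 2 by rewrite a2 b2.
    rewrite -(std_convolution a b mV) /product_measure1.
    apply: eq_integral => x _ /=; congr (std _).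
    by apply/seteqP; split => y; rewrite /xsection /= inE.
  - apply: (bounded_integrable std) => [|x]; last exact: abs_cos_le1.
    exact: measurableT_comp.
rewrite /Rintegral -integral12_prod_meas1//= /fubini_F /=.
transitivity (fine (\int[std]_x (gauss_char w * cos (0 + a * x))%:E)%E).
  congr fine; apply: eq_integral => x _.
  rewrite [LHS](_ : _ = (\int[std]_y cos (a * x + b * y))%:E); last first.
    rewrite -EFin_Rintegral; last exact: integrable_cos_affine.
    by apply: eq_integral => y _ /=; rewrite add0r mul1r.
  by rewrite std_cos_phase -gauss_charE add0r mulrC.
rewrite -/(Rintegral _ _ _) RintegralZl//; last exact: integrable_cos_affine.
by rewrite -gauss_charE mulrC.
Qed.

Lemma gauss_char0 : gauss_char 0 = 1.
Proof.
rewrite /gauss_char; under eq_Rintegral do rewrite sqrtr0 mul0r cos0.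
exact: Rintegral_probability_cst.
Qed.

Lemma gauss_char_natmul (v : R) (n : nat) : 0 <= v ->
  gauss_char (n%:R * v) = gauss_char v ^+ n.
Proof.
move=> v0; elim: n => [|n ih]; first by rewrite mul0r gauss_char0.
by rewrite -natr1 mulrDl mul1r gauss_charD// ?mulr_ge0// ih exprSr.
Qed.

Section normal_variable.
Context d (T : measurableType d) (P : probability T R) (X : T -> R) (v : R).
Hypotheses (v0 : 0 <= v) (mX : measurable_fun setT X)
  (lawX : forall V, measurable V -> P (X @^-1` V) = normal_law 0 v V).

Let lawX_std V : measurable V ->
  P (X @^-1` V) = std ((fun x : R => Num.sqrt v * x) @^-1` V).
Proof.
move=> mV; rewrite lawX//.
by rewrite -[in LHS](sqr_sqrtr v0) normal_law_sqr.
Qed.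

Lemma normal_variable_char (th : R) :
  \int[P]_w cos (th + X w) = cos th * gauss_char v.
Proof.
have m1 := measurable_cos_affine th 1.
transitivity (\int[P]_w cos (th + 1 * X w)).
  by apply: eq_Rintegral => w _; rewrite mul1r.
rewrite (@Rintegral_eq_law _ _ _ _ _ P std X
  (fun x : R => Num.sqrt v * x) (fun x => cos (th + 1 * x)))//.
- under eq_Rintegral do rewrite mul1r.
  by rewrite std_cos_phase -gauss_charE.
- by apply: measurable_funM.
- apply: (bounded_integrable P) => [|x]; last exact: abs_cos_le1.
  exact: measurableT_comp.
- apply: (bounded_integrable std) => [|x]; last exact: abs_cos_le1.
  by apply: measurableT_comp => //; apply: measurable_funM.
Qed.

Lemma normal_variable_sqr_integrable :
  P.-integrable setT (EFin \o (fun w => X w ^+ 2)).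
Proof.
apply: (@integrable_eq_law _ _ _ _ P std X
  (fun x : R => Num.sqrt v * x) (fun x => x ^+ 2)) => //.
- by apply: measurable_funM.
- apply: (@eq_integrable _ _ _ std _ _ (EFin \o (fun x : R => v * x ^+ 2))) => //.
    by move=> x _ /=; rewrite exprMn sqr_sqrtr.
  exact: (@integrableZl _ _ _ _ _ measurableT v _ integrable_std_sqr).
Qed.

End normal_variable.

End gauss_char.

(** * Borel sets of column vectors and Gaussian vectors *)

Section borel_vec_measurability.
Context {R : realType} (k : nat).

Lemma measurable_continuous_borel_vec (g : 'cV[R]_k -> R) : continuous g ->
  measurable_fun setT (g : borel_vec R k -> R).
Proof.
move=> cg; apply: (measurability _ (RGenOpens.measurableE R)).
move=> _ [_ [a [b ->] <-]]; rewrite setTI.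
apply: sub_sigma_algebra.
by apply: open_comp; [move=> ? _; exact: cg|exact: interval_open].
Qed.

Lemma linear_form_continuous (t : 'cV[R]_k) :
  continuous (fun x : 'cV[R]_k => (t^T *m x) 0 0).
Proof.
rewrite (_ : (fun _ => _) = fun x : 'cV[R]_k => \sum_i t i 0 * x i 0).
  have cadd : continuous (fun z : R * R => z.1 + z.2).
    by move=> z; apply: (cvgD (@cvg_fst _ _ _ _ _) (@cvg_snd _ _ _ _ _)).
  apply: (continuous_big cadd) => i _ x.
  exact: (cvgM (cvg_cst (t i 0)) (@coord_continuous R k 1 i 0 x)).
by apply/funext => x; rewrite mxE; apply: eq_bigr => i _; rewrite mxE.
Qed.

Let box (p : {ffun 'I_k -> rat} * nat) : set 'cV[R]_k :=
  [set x | forall i, `|x i 0 - ratr (p.1 i)| < p.2.+1%:R^-1].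

(** There are countably many boxes with rational centre and side, so this makes
    measurability of a vector-valued map a matter of its coordinates. *)
Lemma open_bigcup_box (U : set 'cV[R]_k) : open U ->
  U = \bigcup_(p in [set p | box p `<=` U]) box p.
Proof.
move=> oU; apply/seteqP; split => [x Ux|x [p /= pU px]]; last exact: pU.
have /nbhs_ballP[e /= e0 eU] : nbhs x U by exact: open_nbhs_nbhs.
have e20 : 0 < e / 2 :> R by rewrite divr_gt0.
have [n _ /(_ n (leqnn n)) /= ne] := near_infty_natSinv_lt (PosNum e20).
pose u : R := n.+1%:R^-1.
have u0 : 0 < u by rewrite invr_gt0.
have ue : u < e / 2 by exact: ne.
have /choice[q qx] : forall i : 'I_k, exists q : rat, `|x i 0 - ratr q| < u.
  move=> i; have h : x i 0 - u < x i 0 + u by lra.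
  have [q] := rat_in_itvoo h; rewrite in_itv/= => /andP[q1 q2].
  by exists q; rewrite ltr_norml; apply/andP; split; lra.
exists ([ffun i => q i], n); last by move=> i /=; rewrite ffunE.
move=> y /= yb; apply: eU; split => // i j.
rewrite (ord1 j) /ball/=.
have := yb i; have := qx i; rewrite ffunE -/u => h1 h2.
rewrite (_ : x i 0 - y i 0 = (x i 0 - ratr (q i)) - (y i 0 - ratr (q i))).
  by apply: (le_lt_trans (ler_normB _ _)); lra.
by ring.
Qed.

Lemma measurable_fun_borel_vec d (T : measurableType d) (F : T -> 'cV[R]_k) :
  (forall i, measurable_fun setT (fun w => F w i 0)) ->
  measurable_fun setT (F : T -> borel_vec R k).
Proof.
move=> mF.
have mbox p : measurable (F @^-1` box p).
  rewrite (_ : F @^-1` box p = \bigcap_(i in [set: 'I_k])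
      ((fun w => `|F w i 0 - ratr (p.1 i)|) @^-1` `]-oo, p.2.+1%:R^-1[)).
    apply: fin_bigcap_measurable => // i _.
    rewrite -[X in measurable X]setTI.
    have : measurable_fun setT (fun w => `|F w i 0 - ratr (p.1 i)|).
      by apply: measurableT_comp => //; exact: measurable_funB.
    by apply => //; exact: measurable_itv.
  apply/seteqP; split => w h i; first by move=> _; rewrite /= in_itv/=; exact: h.
  by have := h i I; rewrite /= in_itv/=.
apply: (@measurability _ _ _ (borel_vec R k) setT F (@open 'cV[R]_k)) => //.
move=> _ [U oU <-]; rewrite setTI (open_bigcup_box oU) preimage_bigcup.
rewrite (_ : \bigcup_(p in _) _ = \bigcup_n
   (if unpickle n is Some p then
      if `[< box p `<=` U >] then F @^-1` box p else set0
    else set0)); last first.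
  apply/seteqP; split => w.
    move=> [p /= pU pw]; exists (pickle p) => //; rewrite pickleK.
    by case: ifPn => // /asboolP.
  move=> [n _]; case: unpickle => // p; case: ifPn => // /asboolP pU pw.
  by exists p.
apply: bigcupT_measurable => n; case: unpickle => // p.
by case: ifPn.
Qed.

End borel_vec_measurability.

Lemma pushforward_probability d d' (T : measurableType d)
    (T' : measurableType d') (R : realType) (P : probability T R) (F : T -> T') :
  measurable_fun setT F ->
  exists nu : probability T' R, forall A, nu A = P (F @^-1` A).
Proof.
move=> mF; pose mFm := isMeasurableFun.Build _ _ _ _ F mF.
pose X : {mfun T >-> T'} := HB.pack F mFm.
by exists (distribution P X).
Qed.

(** The law of the sum of the vectors [a] of [s] weighted by independent standard
    normal variables.  These are adjoined one at a time, on the product of the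
    law already built with the standard normal law; linear forms stay normal by
    [std_convolution]. *)
Lemma exists_gaussian_sum (R : realType) (k : nat) (s : seq 'cV[R]_k) :
  exists nu : probability (borel_vec R k) R,
  forall (t : 'cV[R]_k) (V : set R), measurable V ->
    nu [set x : 'cV[R]_k | V ((t^T *m x) 0 0)] =
    normal_law 0 (\sum_(a <- s) ((t^T *m a) 0 0) ^+ 2) V.
Proof.
elim: s => [|a s [nu nuP]].
  exists (dirac (0 : borel_vec R k)) => t V mV.
  rewrite big_nil /normal_law eqxx /dirac !indicE; congr ((nat_of_bool _)%:R%:E).
  by apply/idP/idP; rewrite !inE /= mulmx0 mxE.
pose std := @normal_prob R 0 1.
pose F (p : borel_vec R k * measurableTypeR R) : 'cV[R]_k :=
  (p.1 : 'cV[R]_k) + p.2 *: a.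
have mcoord i : measurable_fun setT
    (fun p : borel_vec R k * measurableTypeR R => (p.1 : 'cV[R]_k) i 0).
  have mc := measurable_continuous_borel_vec (@coord_continuous R k 1 i 0).
  exact: (measurableT_comp mc).
have mF : measurable_fun setT (F : _ -> borel_vec R k).
  apply: measurable_fun_borel_vec => i.
  rewrite (_ : (fun w => _) = (fun p => (p.1 : 'cV[R]_k) i 0 + p.2 * a i 0)).
    by apply: measurable_funD => //; apply: measurable_funM.
  by apply/funext => p; rewrite !mxE.
have [nu' nu'P] := pushforward_probability (nu \x std)%E mF.
exists nu' => t V mV; rewrite nu'P big_cons.
set c := (t^T *m a) 0 0; set v := \sum_(_ <- _) _.
have v0 : 0 <= v by apply: sumr_ge0 => b _; exact: sqr_ge0.
have mt := measurable_continuous_borel_vec (linear_form_continuous (t := t)).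
pose h (u : measurableTypeR R) : \bar R := std [set y | V (u + c * y)].
have mh : measurable_fun setT h.
  pose A : set (measurableTypeR R * measurableTypeR R) :=
    (fun p => p.1 + c * p.2) @^-1` V.
  have mA : measurable A.
    rewrite -[X in measurable X]setTI.
    have : measurable_fun setT
        (fun p : measurableTypeR R * measurableTypeR R => p.1 + c * p.2).
      by apply: measurable_funD => //; apply: measurable_funM.
    exact.
  have := measurable_fun_xsection std mA.
  congr measurable_fun; apply/funext => u; rewrite /h /=; congr (std _).
  by apply/seteqP; split => y; rewrite /xsection /= inE.
have h0 u : (0 <= h u)%E by exact: measure_ge0.
have ms : measurable_fun setT (fun x : measurableTypeR R => Num.sqrt v * x).
  by apply: measurable_funM.
pose l (x : borel_vec R k) : R := (t^T *m (x : 'cV[R]_k)) 0 0.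
transitivity (\int[nu]_x h (l x))%E.
  rewrite /product_measure1; apply: eq_integral => x _ /=; congr (std _).
  have lF y : (t^T *m F (x, y)) 0 0 = l x + c * y.
    by rewrite /F /= mulmxDr mxE -scalemxAr [X in _ + X]mxE [in RHS]mulrC.
  by apply/seteqP; split => y; rewrite /xsection /= inE /= lF.
transitivity (\int[std]_x h (Num.sqrt v * x)%R)%E.
  rewrite -(@ge0_integral_pushforward _ _ _ _ _ _ mt nu setT h)//.
  rewrite -(@ge0_integral_pushforward _ _ _ _ _ _ ms std setT h)//.
  apply: eq_measure_integral => W mW _.
  rewrite /pushforward; apply: etrans (nuP t W mW) _.
  by rewrite -/v -[in LHS](sqr_sqrtr v0) normal_law_sqr.
apply: etrans (std_convolution (Num.sqrt v) c mV) _.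
by rewrite (sqr_sqrtr v0) (addrC v).
Qed.

(** * Bernstein weights, sine coordinates and uniform continuity on boxes *)

Section bernstein.
Context {R : realType}.

(** The probability of [j] successes in [n] independent trials of success
    probability [s].  The recursion is on the outcome of the last trial, which is
    the step of the inductions that compute the moments. *)
Fixpoint bernstein (s : R) (n j : nat) : R :=
  if n is n'.+1 then
    s * (if j is j'.+1 then bernstein s n' j' else 0)
    + (1 - s) * bernstein s n' j
  else (j == 0%N)%:R.

Lemma bernstein_gt (s : R) (n j : nat) : (n < j)%N -> bernstein s n j = 0.
Proof.
elim: n j => [|n ih] [|j]//= nj.
by rewrite !ih ?mulr0 ?addr0// ltnW.
Qed.

Lemma bernstein_ge0 (s : R) (n j : nat) : 0 <= s <= 1 -> 0 <= bernstein s n j.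
Proof.
move=> /andP[s0 s1]; elim: n j => [|n ih] j /=; first exact: ler0n.
rewrite addr_ge0// mulr_ge0// ?subr_ge0//.
by case: j => [|j].
Qed.

Lemma bernstein_sumS (s : R) (n : nat) (g : nat -> R) :
  \sum_(j < n.+2) bernstein s n.+1 j * g j =
  s * (\sum_(j < n.+1) bernstein s n j * g j.+1)
  + (1 - s) * (\sum_(j < n.+1) bernstein s n j * g j).
Proof.
transitivity (\sum_(j < n.+2)
    s * ((if nat_of_ord j is j'.+1 then bernstein s n j' else 0) * g j) +
  \sum_(j < n.+2) (1 - s) * (bernstein s n j * g j)).
  by rewrite -big_split/=; apply: eq_bigr => j _; rewrite mulrDl !mulrA.
rewrite -!mulr_sumr; congr (_ * _ + _ * _).
  by rewrite big_ord_recl/= mul0r add0r.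
by rewrite big_ord_recr/= bernstein_gt// mul0r addr0.
Qed.

Lemma bernstein_sum1 (s : R) (n : nat) : \sum_(j < n.+1) bernstein s n j = 1.
Proof.
elim: n => [|n ih]; first by rewrite big_ord1.
under eq_bigr do rewrite -[bernstein _ _ _]mulr1.
rewrite (bernstein_sumS s n (fun=> 1)).
under eq_bigr do rewrite mulr1.
by rewrite ih; ring.
Qed.

Lemma bernstein_mean (s : R) (n : nat) :
  \sum_(j < n.+1) bernstein s n j * (j%:R - n%:R * s) = 0.
Proof.
elim: n => [|n ih]; first by rewrite big_ord1/= mul0r subrr mulr0.
rewrite (bernstein_sumS s n (fun j => j%:R - n.+1%:R * s)).
have sh (c : R) : \sum_(j < n.+1) bernstein s n j * (j%:R - n%:R * s + c) = c.
  under eq_bigr do rewrite mulrDr.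
  by rewrite big_split/= ih add0r -mulr_suml bernstein_sum1 mul1r.
rewrite (eq_bigr (fun j : 'I_n.+1 => bernstein s n j * (j%:R - n%:R * s + (1 - s)))).
  rewrite sh (eq_bigr (fun j : 'I_n.+1 =>
      bernstein s n j * (j%:R - n%:R * s + (- s)))).
    by rewrite sh; ring.
  by move=> j _; congr (_ * _); rewrite -natr1; ring.
by move=> j _; congr (_ * _); rewrite -!natr1; ring.
Qed.

Lemma bernstein_variance (s : R) (n : nat) :
  \sum_(j < n.+1) bernstein s n j * (j%:R - n%:R * s) ^+ 2 =
  n%:R * (s * (1 - s)).
Proof.
elim: n => [|n ih]; first by rewrite big_ord1/= !mul0r subrr expr0n mulr0.
rewrite (bernstein_sumS s n (fun j => (j%:R - n.+1%:R * s) ^+ 2)).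
have sh (c : R) : \sum_(j < n.+1) bernstein s n j * (j%:R - n%:R * s + c) ^+ 2 =
    n%:R * (s * (1 - s)) + c ^+ 2.
  rewrite (eq_bigr (fun j : 'I_n.+1 =>
    bernstein s n j * (j%:R - n%:R * s) ^+ 2 +
    (2 * c * (bernstein s n j * (j%:R - n%:R * s)) + bernstein s n j * c ^+ 2))).
    rewrite !big_split/= ih -mulr_sumr bernstein_mean -mulr_suml bernstein_sum1.
    by ring.
  by move=> j _; ring.
rewrite (eq_bigr (fun j : 'I_n.+1 =>
    bernstein s n j * (j%:R - n%:R * s + (1 - s)) ^+ 2)).
  rewrite sh (eq_bigr (fun j : 'I_n.+1 =>
      bernstein s n j * (j%:R - n%:R * s + (- s)) ^+ 2)).
    by rewrite sh -natr1; ring.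
  by move=> j _; congr (_ * _ ^+ 2); rewrite -natr1; ring.
by move=> j _; congr (_ * _ ^+ 2); rewrite -!natr1; ring.
Qed.

(** The frequency of successes has variance [s (1 - s) / n.+1]. *)
Lemma bernstein_dispersion (s : R) (n : nat) : 0 <= s <= 1 ->
  \sum_(j < n.+2) bernstein s n.+1 j * (j%:R / n.+1%:R - s) ^+ 2
  <= n.+1%:R^-1.
Proof.
move=> /andP[s0 s1].
rewrite (eq_bigr (fun j : 'I_n.+2 =>
  n.+1%:R ^- 2 * (bernstein s n.+1 j * (j%:R - n.+1%:R * s) ^+ 2))); last first.
  by move=> j _; field.
rewrite -mulr_sumr bernstein_variance.
rewrite (_ : n.+1%:R ^- 2 * _ = n.+1%:R^-1 * (s * (1 - s))); last by field.
by rewrite ler_piMr//; nra.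
Qed.

(** Distributing the product over the sums, every coordinate that is not observed
    contributes a factor [1]. *)
Lemma bernstein_prod_sum1 (k n : nat) (s : 'I_k -> R) :
  \sum_(J : {ffun 'I_k -> 'I_n.+1}) \prod_i bernstein (s i) n (J i) = 1.
Proof.
rewrite -(bigA_distr_bigA (fun i (j : 'I_n.+1) => bernstein (s i) n j))/=.
by rewrite big1// => i _; exact: bernstein_sum1.
Qed.

Lemma bernstein_prod_marginal (k n : nat) (s : 'I_k -> R) (i0 : 'I_k)
    (g : 'I_n.+1 -> R) :
  \sum_(J : {ffun 'I_k -> 'I_n.+1})
    (\prod_i bernstein (s i) n (J i)) * g (J i0) =
  \sum_(j < n.+1) bernstein (s i0) n j * g j.
Proof.
pose F i (j : 'I_n.+1) := bernstein (s i) n j * (if i == i0 then g j else 1).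
transitivity (\sum_(J : {ffun 'I_k -> 'I_n.+1}) \prod_i F i (J i)).
  apply: eq_bigr => J _; rewrite /F big_split/=; congr (_ * _).
  by rewrite -big_mkcond/= big_pred1_eq.
rewrite -(bigA_distr_bigA F)/= (bigD1 i0)//= /F eqxx.
rewrite [X in _ * X]big1 ?mulr1// => i ii0.
by rewrite (negbTE ii0); under eq_bigr do rewrite mulr1; exact: bernstein_sum1.
Qed.

End bernstein.

Section sine_coordinate.
Context {R : realType}.

(** The cosine is at least [1 / 2] between [-1] and [1]. *)
Lemma sin_half_lipschitz_below (x y : R) : -1 <= y -> y <= x -> x <= 1 ->
  (x - y) / 2 <= sin x - sin y.
Proof.
move=> y1 yx x1.
pose f (u : R) := sin u - u / 2.
suff : f y <= f x by rewrite /f; lra.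
have fdf (u : R) : is_derive u 1 f (cos u - 1 / 2).
  by apply: is_derive_eq; rewrite !scaler0 /GRing.scale/=; ring.
apply: (@ger0_derive1_le_cc _ f (-1) 1); rewrite ?in_itv/= ?yx ?y1//=.
- move=> u; rewrite in_itv/= => /andP[u1 u2].
  rewrite derive1E derive_val.
  have := cos_ge_quadratic u.
  have : 0 <= (1 - u) * (1 + u) by rewrite mulr_ge0//; lra.
  rewrite (_ : (1 - u) * (1 + u) = 1 - u ^+ 2); last by ring.
  by lra.
- by apply: derivable_within_continuous => u _; apply: ex_derive.
- by rewrite (le_trans yx x1).
- by rewrite x1 (le_trans y1 yx).
Qed.

Lemma sin_half_lipschitz (x y : R) : `|x| <= 1 -> `|y| <= 1 ->
  `|x - y| <= 2 * `|sin x - sin y|.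
Proof.
wlog yx : x y / y <= x => [wlg|].
  have [yx|/ltW xy] := leP y x; first exact: wlg.
  by move=> x1 y1; rewrite distrC (distrC (sin x)); exact: wlg.
rewrite !ler_norml => /andP[x1 x2] /andP[y1 y2].
have := sin_half_lipschitz_below y1 yx x2.
have : 0 <= x - y by rewrite subr_ge0.
move=> h1 h2; rewrite !ger0_norm//; lra.
Qed.

(** The sine at [y] is the point nearest to [z] in the range of the sine over
    [-1 .. 1]; replacing [z] by it does not increase the distance to any [sin x]. *)
Lemma sin_node (z : R) : exists2 y : R, `|y| <= 1 &
  forall x, `|x| <= 1 -> `|x - y| <= 2 * `|sin x - z|.
Proof.
have s1 : 0 <= sin (1 : R) by have := @sin_ge_cubic R 1 ler01; rewrite expr1n; lra.
pose z' := Num.max (- sin 1) (Num.min (sin 1) z).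
have [y] : exists2 y, y \in `[(-1 : R), 1] & sin y = z'.
  apply: IVT; first lra.
    by apply: continuous_subspaceT; exact: continuous_sin.
  rewrite sinN /z'; apply/andP; split.
    by rewrite ge_min le_max lexx.
  by rewrite le_max ge_max ge_min lexx/= orbC ge_max ge_min lexx /= andbT; lra.
rewrite in_itv/= => yb yz; exists y; first by rewrite ler_norml.
move=> x x1; apply: le_trans (sin_half_lipschitz x1 _) _; first by rewrite ler_norml.
rewrite ler_pM2l// yz /z'.
have sm (u : R) : `|u| <= 1 -> sin u <= sin 1.
  move=> u1; have := @sin_half_lipschitz_below 1 u.
  move: u1; rewrite ler_norml => /andP[h1 h2] /(_ h1 h2 (lexx _)); lra.
have sx1 : sin x <= sin 1 by exact: sm.
have sx2 : - sin 1 <= sin x.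
  by rewrite lerNl -sinN sm// normrN.
case: (lerP (sin 1) z) => h1.
  by rewrite max_r; [rewrite !ler0_norm; lra|lra].
case: (lerP (- sin 1) z) => h2 //.
by rewrite !ger0_norm; lra.
Qed.

End sine_coordinate.

Section uniform_continuity.
Context {R : realType} (k : nat).

(** Heine's theorem: a box of row vectors is compact as a product of segments,
    and transposition carries this over to column vectors. *)
Lemma uniform_continuity_box (f : 'cV[R]_k -> R) (L e : R) :
  continuous f -> 0 < e ->
  exists2 r : R, 0 < r & forall x y : 'cV[R]_k, (forall i, `|x i 0| <= L) ->
    (forall i, `|x i 0 - y i 0| < r) -> `|f x - f y| < e.
Proof.
move=> cf e0.
pose K : set 'rV[R]_k := [set v | forall i, `[- L, L]%classic (v ord0 i)].
have cK : compact K.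
  exact: (@rV_compact R k (fun=> `[- L, L]%classic)
    (fun=> @segment_compact R (- L) L)).
pose P (r : R) (v : 'rV[R]_k) := forall y : 'cV[R]_k,
  (forall i, `|v ord0 i - y i 0| < r) -> `|f v^T - f y| < e.
have : forall x, K x -> \forall x' \near x & i \near 0^'+, P i x'.
  move=> x Kx.
  have /cvgrPdist_lt/(_ (e / 2)) := cf x^T.
  rewrite divr_gt0// => /(_ erefl) /nbhs_ballP[r /= r0 rf].
  have r2 : 0 < r / 2 by rewrite divr_gt0.
  exists (ball x (r / 2), [set s | s < r / 2]) => /=.
    by split; [exact: nbhsx_ballx|exact: nbhs_right_lt].
  move=> [x' s]/= [[_ xx'] sr] y x'y.
  have b1 : ball x^T r x'^T.
    split => // i j; rewrite !mxE; apply: lt_le_trans (xx' j i) _.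
    by rewrite ler_pdivrMr//; lra.
  have b2 : ball x^T r y.
    split => // i j; rewrite !mxE (ord1 j) /ball/=.
    have h1 := xx' ord0 i; rewrite /ball/= in h1.
    have h2 := x'y i.
    rewrite (_ : x ord0 i - y i 0 =
      (x ord0 i - x' ord0 i) + (x' ord0 i - y i 0)); last by ring.
    by apply: (le_lt_trans (ler_normD _ _)); lra.
  have := rf _ b1; have := rf _ b2.
  rewrite (_ : f x'^T - f y = (f x^T - f y) - (f x^T - f x'^T)); last by ring.
  by move=> h1 h2; apply: (le_lt_trans (ler_normB _ _)); lra.
move/compact_near_coveringP : cK => cK h.
have Pnear := cK R (0 : R)^'+ P _ h.
have [r [r0 Pr]] : exists r : R, 0 < r /\ K `<=` P r.
  near (0 : R)^'+ => r; exists r; split; last by near: r; exact: Pnear.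
  by near: r; exact: nbhs_right_gt.
exists r => // x y xL xy.
rewrite -(trmxK x); apply: Pr; last by move=> i; rewrite mxE.
by move=> i; rewrite /= mxE in_itv/= -ler_norml.
Unshelve. all: by end_near. Qed.

End uniform_continuity.

(** * Trigonometric polynomials *)

Section trigonometric_polynomials.
Context {R : realType} {k : nat}.
Implicit Types f g : 'cV[R]_k -> R.

Definition phase (th : R) (t x : 'cV[R]_k) : R := th + (t^T *m x) 0 0.

Inductive trig_poly : ('cV[R]_k -> R) -> Prop :=
| trig_cos th t : trig_poly (fun x => cos (phase th t x))
| trig_add f g : trig_poly f -> trig_poly g -> trig_poly (fun x => f x + g x)
| trig_scale c f : trig_poly f -> trig_poly (fun x => c * f x).

Lemma trig_cst c : trig_poly (fun=> c).
Proof.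
rewrite (_ : (fun=> c) = (fun x => c * cos (phase 0 0 x))).
  exact/trig_scale/trig_cos.
by apply/funext => x; rewrite /phase trmx0 mul0mx mxE addr0 cos0 mulr1.
Qed.

Lemma trig_mul f g : trig_poly f -> trig_poly g -> trig_poly (fun x => f x * g x).
Proof.
move=> Hf Hg; elim: Hf => [th t|f1 f2 _ h1 _ h2|c f1 _ h1]; first last.
- rewrite (_ : (fun x => _) = (fun x => c * (f1 x * g x))); first exact: trig_scale.
  by apply/funext => x; rewrite mulrA.
- rewrite (_ : (fun x => _) = (fun x => f1 x * g x + f2 x * g x)).
    exact: trig_add.
  by apply/funext => x; rewrite mulrDl.
elim: Hg => [th' t'|f1 f2 _ h1 _ h2|c f1 _ h1]; first last.
- rewrite (_ : (fun x => _) = (fun x => c * (cos (phase th t x) * f1 x))).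
    exact: trig_scale.
  by apply/funext => x; rewrite mulrCA.
- rewrite (_ : (fun x => _) = (fun x => cos (phase th t x) * f1 x
                                      + cos (phase th t x) * f2 x)).
    exact: trig_add.
  by apply/funext => x; rewrite mulrDr.
rewrite (_ : (fun x => _) = (fun x =>
  2^-1 * cos (phase (th + th') (t + t') x) +
  2^-1 * cos (phase (th - th') (t - t') x))).
  by apply: trig_add; exact/trig_scale/trig_cos.
apply/funext => x; rewrite /phase !linearD/= linearN/= mulmxDl mulmxBl !mxE.
set a := \sum_j _; set b := \sum_j _.
rewrite (_ : th + th' + (a + b) = (th + a) + (th' + b)); last by ring.
rewrite (_ : th - th' + (a - b) = (th + a) - (th' + b)); last by ring.
move: (th + a) (th' + b) => u w.
by rewrite cosD cosB; field.
Qed.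

Lemma trig_sum (I : Type) (r : seq I) (F : I -> 'cV[R]_k -> R) :
  (forall i, trig_poly (F i)) -> trig_poly (fun x => \sum_(i <- r) F i x).
Proof.
move=> HF; elim: r => [|i r ih].
  by rewrite (_ : (fun x => _) = (fun=> 0));
    [exact: trig_cst|apply/funext => x; rewrite big_nil].
rewrite (_ : (fun x => _) = (fun x => F i x + \sum_(j <- r) F j x)).
  exact: trig_add.
by apply/funext => x; rewrite big_cons.
Qed.

Lemma trig_prod (I : Type) (r : seq I) (F : I -> 'cV[R]_k -> R) :
  (forall i, trig_poly (F i)) -> trig_poly (fun x => \prod_(i <- r) F i x).
Proof.
move=> HF; elim: r => [|i r ih].
  by rewrite (_ : (fun x => _) = (fun=> 1));
    [exact: trig_cst|apply/funext => x; rewrite big_nil].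
rewrite (_ : (fun x => _) = (fun x => F i x * \prod_(j <- r) F j x)).
  exact: trig_mul.
by apply/funext => x; rewrite big_cons.
Qed.

Lemma trig_bernstein f n j : trig_poly f ->
  trig_poly (fun x => bernstein (f x) n j).
Proof.
move=> Hf; elim: n j => [|n ih] j /=; first exact: trig_cst.
apply: trig_add; apply: trig_mul => //.
  by case: j => [|j] //; exact: trig_cst.
rewrite (_ : (fun x => _) = (fun x => 1 + -1 * f x)).
  by apply: trig_add; [exact: trig_cst|exact: trig_scale].
by apply/funext => x; rewrite mulN1r.
Qed.

Lemma phase_coord (c th : R) (i : 'I_k) (x : 'cV[R]_k) :
  phase th (c *: delta_mx i 0) x = th + c * x i 0.
Proof.
rewrite /phase linearZ/= trmx_delta -scalemxAl mxE; congr (_ + _ * _).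
by rewrite -rowE mxE.
Qed.

Lemma trig_sin_coord (c : R) (i : 'I_k) :
  trig_poly (fun x => (1 + sin (c * x i 0)) / 2).
Proof.
rewrite (_ : (fun x => _) = (fun x =>
  2^-1 + 2^-1 * cos (phase (- (pi / 2)) (c *: delta_mx i 0) x))).
  by apply: trig_add; [exact: trig_cst|exact/trig_scale/trig_cos].
by apply/funext => x; rewrite phase_coord (addrC (- _)) cosBpihalf; field.
Qed.

(** The approximant is a Bernstein polynomial in the variables
    [(1 + sin (x_i / L)) / 2]: these lie in [0, 1] for every [x], which keeps
    the bound [M] on the whole space, and they separate the points of the box. *)
Lemma trig_approximation f (M L e : R) : continuous f ->
  (forall x, `|f x| <= M) -> 0 < L -> 0 < e ->
  exists T : 'cV[R]_k -> R, [/\ trig_poly T, (forall x, `|T x| <= M) &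
    forall x : 'cV[R]_k, (forall i, `|x i 0| <= L) -> `|T x - f x| <= e].
Proof.
move=> cf fM L0 e0.
have M0 : 0 <= M by apply: le_trans (fM 0); exact: normr_ge0.
have [r r0 fr] := uniform_continuity_box L cf (divr_gt0 e0 (ltr0Sn R 1)).
pose A := 32 * M * L ^+ 2 / r ^+ 2.
have A0 : 0 <= A.
  apply: divr_ge0; last exact: sqr_ge0.
  by apply: mulr_ge0; [exact: mulr_ge0|exact: sqr_ge0].
pose C := A * k%:R.
have C0 : 0 <= C by rewrite mulr_ge0.
have [n Cn] : exists n : nat, C / n.+1%:R <= e / 2.
  exists (Num.truncn (C / (e / 2))).
  rewrite ler_pdivrMr// mulrC -ler_pdivrMr ?divr_gt0//.
  by rewrite ltW// truncnS_gt.
have /choice[node nodeP] : forall z : R, exists y, `|y| <= 1 /\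
    forall x, `|x| <= 1 -> `|x - y| <= 2 * `|sin x - z|.
  by move=> z; have [y y1 yz] := sin_node z; exists y.
have node1 z : `|node z| <= 1 by have [] := nodeP z.
have nodeS z x : `|x| <= 1 -> `|x - node z| <= 2 * `|sin x - z|.
  by have [_] := nodeP z; exact.
pose s (x : 'cV[R]_k) (i : 'I_k) := (1 + sin (L^-1 * x i 0)) / 2.
have s01 x i : 0 <= s x i <= 1.
  have := sin_geN1 (L^-1 * x i 0); have := sin_le1 (L^-1 * x i 0).
  by rewrite /s => h1 h2; apply/andP; split; lra.
pose W (J : {ffun 'I_k -> 'I_n.+2}) x := \prod_i bernstein (s x i) n.+1 (J i).
have W0 J x : 0 <= W J x.
  by apply: prodr_ge0 => i _; exact: bernstein_ge0.
have W1 x : \sum_J W J x = 1 by exact: bernstein_prod_sum1.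
pose y (J : {ffun 'I_k -> 'I_n.+2}) : 'cV[R]_k :=
  \col_i (L * node (2 * ((J i)%:R / n.+1%:R) - 1)).
pose T x := \sum_J W J x * f (y J).
exists T; split.
- apply: trig_sum => J; apply: trig_mul; last exact: trig_cst.
  by apply: trig_prod => i; apply: trig_bernstein; exact: trig_sin_coord.
- move=> x; apply: le_trans (ler_norm_sum _ _ _) _.
  rewrite -[leRHS]mul1r -(W1 x) mulr_suml; apply: ler_sum => J _.
  by rewrite normrM (ger0_norm (W0 _ _)) ler_wpM2l.
move=> x xL.
pose D (J : {ffun 'I_k -> 'I_n.+2}) i := ((J i)%:R / n.+1%:R - s x i) ^+ 2.
have D0 J i : 0 <= D J i by exact: sqr_ge0.
(* Either [y J] is close to [x], or some coordinate of [s x] is far from the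
   corresponding frequency and the dispersion term exceeds [2 M]. *)
have point J : `|f (y J) - f x| <=
    e / 2 + A * \sum_i D J i.
  have [xy|/existsNP[i xy]] := pselect (forall i, `|x i 0 - y J i 0| < r).
    rewrite distrC; apply: le_trans (ltW (fr _ _ xL xy)) _.
    by rewrite lerDl mulr_ge0// sumr_ge0.
  have {}xy : r <= `|x i 0 - y J i 0| by rewrite leNgt; exact/negP.
  have xi1 : `|L^-1 * x i 0| <= 1.
    by rewrite normrM gtr0_norm ?invr_gt0// mulrC ler_pdivrMr// mul1r.
  have h : r <= 4 * L * `|(J i)%:R / n.+1%:R - s x i|.
    apply: (le_trans xy); rewrite mxE.
    rewrite (_ : x i 0 - _ =
      L * (L^-1 * x i 0 - node (2 * ((J i)%:R / n.+1%:R) - 1))); last first.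
      by field; rewrite gt_eqF.
    rewrite normrM (gtr0_norm L0) (mulrC 4) -mulrA ler_pM2l//.
    apply: le_trans (nodeS _ _ xi1) _.
    rewrite (_ : sin _ - _ = - 2 * ((J i)%:R / n.+1%:R - s x i)); last first.
      by rewrite /s; field.
    by rewrite normrM normrN (ger0_norm (ler0n _ 2)) mulrA -natrM.
  have h2 : r ^+ 2 <= 16 * L ^+ 2 * D J i.
    rewrite (_ : 16 * _ * _ = (4 * L * `|(J i)%:R / n.+1%:R - s x i|) ^+ 2).
      by rewrite ler_sqr ?nnegrE// ?(ltW r0)// (le_trans (ltW r0) h).
    by rewrite !exprMn real_normK ?num_real// /D; ring.
  have h3 : D J i <= \sum_i D J i.
    by rewrite (bigD1 i)//= lerDl sumr_ge0.
  have h4 : `|f (y J) - f x| <= 2 * M.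
    apply: (le_trans (ler_normB _ _)).
    by have := fM (y J); have := fM x; lra.
  apply: (le_trans h4).
  apply: (@le_trans _ _ (A * D J i)).
    rewrite (_ : A * _ = 2 * M * ((16 * L ^+ 2 * D J i) / r ^+ 2)).
      by rewrite ler_peMr ?mulr_ge0// ler_pdivlMr ?exprn_gt0// mul1r.
    by rewrite /A; field; rewrite gt_eqF.
  apply: (@le_trans _ _ (A * \sum_i D J i)).
    exact: ler_wpM2l.
  by rewrite lerDr divr_ge0// ltW.
have -> : T x - f x = \sum_J W J x * (f (y J) - f x).
  rewrite /T -[X in _ - X]mul1r -(W1 x) mulr_suml -sumrB.
  by apply: eq_bigr => J _; rewrite mulrBr.
apply: le_trans (ler_norm_sum _ _ _) _.
apply: (@le_trans _ _ (\sum_J W J x *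
    (e / 2 + A * \sum_i D J i))).
  apply: ler_sum => J _; rewrite normrM (ger0_norm (W0 _ _)).
  exact: ler_wpM2l.
under eq_bigr do rewrite mulrDr.
rewrite big_split/= -mulr_suml W1 mul1r.
suff : \sum_J W J x * (A * \sum_i D J i) <= C / n.+1%:R.
  by move=> h; rewrite [leRHS]splitr lerD2l (le_trans h Cn).
have -> : \sum_J W J x * (A * \sum_i D J i) =
    A * \sum_i \sum_J W J x * D J i.
  rewrite exchange_big/= mulr_sumr; apply: eq_bigr => J _.
  by rewrite mulrCA mulr_sumr.
rewrite /C -mulrA; apply: ler_wpM2l => //.
rewrite -[k in k%:R](card_ord k) mulrC mulr_natr -sumr_const.
apply: ler_sum => i _.
rewrite (bernstein_prod_marginal (s x) i
  (fun j => ((j : nat)%:R / n.+1%:R - s x i) ^+ 2)).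
exact: bernstein_dispersion.
Qed.

End trigonometric_polynomials.

(** * Convergence in distribution from characteristic functions *)

Section levy.
Context {R : realType} {k : nat}.

Lemma trig_poly_continuous (f : 'cV[R]_k -> R) : trig_poly f -> continuous f.
Proof.
elim=> [th t|f1 f2 _ c1 _ c2|c f1 _ c1] x.
- have h : {for x, continuous (fun x : 'cV[R]_k => phase th t x)}.
    exact: (cvgD (cvg_cst th) (@linear_form_continuous R k t x)).
  exact: (@continuous_comp _ _ _ _ (@cos R) x h (@continuous_cos R _)).
- exact: (cvgD (c1 x) (c2 x)).
- exact: (cvgM (cvg_cst c) (c1 x)).
Qed.

Lemma trig_poly_bounded (f : 'cV[R]_k -> R) : trig_poly f ->
  exists M, forall x, `|f x| <= M.
Proof.
elim=> [th t|f1 f2 _ [M1 h1] _ [M2 h2]|c f1 _ [M h]].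
- by exists 1 => x; exact: abs_cos_le1.
- exists (M1 + M2) => x; apply: (le_trans (ler_normD _ _)).
  by rewrite lerD.
- by exists (`|c| * M) => x; rewrite normrM ler_wpM2l.
Qed.

Section random_vector.
Context d (T : measurableType d) (P : probability T R) (Z : T -> 'cV[R]_k).
Hypothesis mZ : measurable_fun setT (Z : T -> borel_vec R k).

Lemma integrable_bounded_comp (f : 'cV[R]_k -> R) (M : R) : continuous f ->
  (forall x, `|f x| <= M) -> P.-integrable setT (EFin \o (f \o Z)).
Proof.
move=> cf fM; apply: (@bounded_integrable _ _ _ _ _ M) => [|w]; last exact: fM.
exact: (measurableT_comp (measurable_continuous_borel_vec cf) mZ).
Qed.

Lemma integrable_trig_comp (f : 'cV[R]_k -> R) : trig_poly f ->
  P.-integrable setT (EFin \o (f \o Z)).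
Proof.
move=> tf; have [M fM] := trig_poly_bounded tf.
exact: (integrable_bounded_comp (trig_poly_continuous tf) fM).
Qed.

(** Chebyshev's inequality controls the error outside the box. *)
Lemma expectation_box_error (f g : 'cV[R]_k -> R) (M L e C : R) :
  continuous f -> continuous g ->
  (forall x, `|f x| <= M) -> (forall x, `|g x| <= M) -> 0 < L -> 0 <= e ->
  (forall x : 'cV[R]_k, (forall i, `|x i 0| <= L) -> `|g x - f x| <= e) ->
  (forall i, P.-integrable setT (EFin \o (fun w => Z w i 0 ^+ 2))) ->
  (forall i, \int[P]_w (Z w i 0 ^+ 2) <= C) ->
  `|\int[P]_w g (Z w) - \int[P]_w f (Z w)| <= e + 2 * M / L ^+ 2 * (k%:R * C).
Proof.
move=> cf cg fM gM L0 e0 fg iZ ZC.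
have M0 : 0 <= M by apply: le_trans (fM 0); exact: normr_ge0.
have ifZ := integrable_bounded_comp cf fM.
have igZ := integrable_bounded_comp cg gM.
have igf : P.-integrable setT (EFin \o (fun w => g (Z w) - f (Z w))).
  exact: (@integrableB _ _ _ _ _ measurableT _ _ igZ ifZ).
have isum : P.-integrable setT (EFin \o (fun w => \sum_i Z w i 0 ^+ 2)).
  exact: (integrable_finsum iZ).
have ie : P.-integrable setT (EFin \o cst e).
  exact: finite_measure_integrable_cst.
have isc : P.-integrable setT
    (EFin \o (fun w => 2 * M / L ^+ 2 * \sum_i Z w i 0 ^+ 2)).
  exact: (@integrableZl _ _ _ _ _ measurableT (2 * M / L ^+ 2) _ isum).
have c0 : 0 <= 2 * M / L ^+ 2 by rewrite divr_ge0 ?exprn_ge0 ?mulr_ge0// ltW.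
rewrite -RintegralB//.
apply: (le_trans (le_normr_Rintegral measurableT igf)).
apply: (@le_trans _ _
  (\int[P]_w (cst e w + 2 * M / L ^+ 2 * \sum_i Z w i 0 ^+ 2))).
  apply: le_Rintegral => //.
  - exact: (integrable_norm igf).
  - exact: (@integrableD _ _ _ _ _ measurableT _ _ ie isc).
  move=> w _ /=.
  have s0 : 0 <= \sum_i Z w i 0 ^+ 2 by apply: sumr_ge0 => i _; exact: sqr_ge0.
  have [ZL|/existsNP[i ZL]] := pselect (forall i, `|Z w i 0| <= L).
    by apply: (le_trans (fg _ ZL)); rewrite lerDl mulr_ge0.
  have {}ZL : L <= `|Z w i 0| by rewrite leNgt; apply/negP => /ltW.
  apply: (@le_trans _ _ (2 * M)).
    apply: (le_trans (ler_normB _ _)).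
    by have := fM (Z w); have := gM (Z w); lra.
  apply: (@le_trans _ _ (2 * M / L ^+ 2 * \sum_i Z w i 0 ^+ 2)); last first.
    by rewrite lerDr.
  rewrite -mulrA ler_peMr ?mulr_ge0// mulrC ler_pdivlMr ?exprn_gt0// mul1r.
  apply: (@le_trans _ _ (Z w i 0 ^+ 2)).
    by rewrite -[leRHS]real_normK ?num_real// ler_sqr ?nnegrE// ltW.
  rewrite (bigD1 i)//= lerDl; apply: sumr_ge0 => j _; exact: sqr_ge0.
rewrite RintegralD// Rintegral_probability_cst lerD2l RintegralZl//.
apply: ler_wpM2l => //.
rewrite [leLHS](_ : _ = \sum_i \int[P]_w (Z w i 0 ^+ 2)).
  rewrite -[k in k%:R](card_ord k) mulr_natl -sumr_const.
  by apply: ler_sum => i _; exact: ZC.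
exact: (Rintegral_finsum iZ).
Qed.

End random_vector.

(** A form of Levy's continuity theorem: tightness comes from second moments,
    and the trigonometric polynomials, whose expectations converge by
    hypothesis, approximate a bounded continuous function on large boxes while
    keeping its bound. *)
Lemma cvg_in_distribution_char d (T : measurableType d) (P : probability T R)
    (X : nat -> T -> 'cV[R]_k) (nu : probability (borel_vec R k) R) (C : R) :
  (forall N, measurable_fun setT (X N : T -> borel_vec R k)) ->
  (forall N i, P.-integrable setT (EFin \o (fun w => X N w i 0 ^+ 2))) ->
  (forall N i, \int[P]_w (X N w i 0 ^+ 2) <= C) ->
  (forall i, nu.-integrable setT
     (EFin \o (fun x : borel_vec R k => (x : 'cV[R]_k) i 0 ^+ 2))) ->
  (forall th t, \int[P]_w cos (phase th t (X N w)) @[N --> \oo] -->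
     \int[nu]_x cos (phase th t (x : 'cV[R]_k))) ->
  cvg_in_distribution P X nu.
Proof.
move=> mX iX XC inu char f cf [M fM].
have mid : measurable_fun setT ((fun x => x) : borel_vec R k -> borel_vec R k).
  exact: measurable_id.
have tcvg g : trig_poly g -> \int[P]_w g (X N w) @[N --> \oo] -->
    \int[nu]_x g (x : 'cV[R]_k).
  elim=> [th t|f1 f2 t1 c1 t2 c2|c f1 t1 c1]; first exact: char.
  - rewrite RintegralD//;
      [|exact: (integrable_trig_comp nu mid t1)
       |exact: (integrable_trig_comp nu mid t2)].
    rewrite (_ : (fun N => _) = (fun N =>
        \int[P]_w f1 (X N w) + \int[P]_w f2 (X N w))); first exact: cvgD.
    apply/funext => N; rewrite RintegralD//;
      [exact: (integrable_trig_comp P (mX N) t1)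
      |exact: (integrable_trig_comp P (mX N) t2)].
  - rewrite RintegralZl//; last exact: (integrable_trig_comp nu mid t1).
    rewrite (_ : (fun N => _) = (fun N => c * \int[P]_w f1 (X N w))).
      by apply: cvgM => //; exact: cvg_cst.
    apply/funext => N; rewrite RintegralZl//.
    exact: (integrable_trig_comp P (mX N) t1).
have ifnu := integrable_bounded_comp nu mid cf fM.
have ifX N := integrable_bounded_comp P (mX N) cf fM.
rewrite (EFin_Rintegral ifnu).
apply: cvg_EFin; first by near=> N; exact: (integrable_fin_num _ (ifX N)).
rewrite -/(Rintegral _ _ _).
apply/cvgrPdist_le => e e0.
pose C' := \big[Order.max/`|C|]_i
  (\int[nu]_x ((x : 'cV[R]_k) i 0 ^+ 2)).
have C'ge i : \int[nu]_x ((x : 'cV[R]_k) i 0 ^+ 2) <= C' by exact: le_bigmax.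
have CC' : C <= C'.
  by apply: (le_trans (ler_norm C)); exact: bigmax_ge_id.
have C'0 : 0 <= C' by apply: le_trans (normr_ge0 C) _; exact: bigmax_ge_id.
have M0 : 0 <= M by apply: le_trans (fM 0); exact: normr_ge0.
pose D := 2 * M * (k%:R * C').
have D0 : 0 <= D by rewrite !mulr_ge0.
(* With this half-width the contribution of the outside of the box, which is
   [D / L ^+ 2], is at most [e / 8]. *)
pose L := 1 + D / (e / 8).
have L1 : 1 <= L by rewrite lerDl divr_ge0// divr_ge0// ltW.
have L0 : 0 < L by apply: lt_le_trans L1.
have DL : D / L ^+ 2 <= e / 8.
  rewrite ler_pdivrMr ?exprn_gt0// mulrC -ler_pdivrMr ?divr_gt0//.
  apply: (@le_trans _ _ L); first by rewrite lerDr.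
  by rewrite expr2 ler_peMr// ltW.
have e8 : 0 < e / 8 by rewrite divr_gt0.
have [g [tg gM gf]] := trig_approximation cf fM L0 e8.
have cg := trig_poly_continuous tg.
have err d' (T' : measurableType d') (P' : probability T' R) (Z : T' -> 'cV[R]_k) :
    measurable_fun setT (Z : T' -> borel_vec R k) ->
    (forall i, P'.-integrable setT (EFin \o (fun w => Z w i 0 ^+ 2))) ->
    (forall i, \int[P']_w (Z w i 0 ^+ 2) <= C') ->
    `|\int[P']_w g (Z w) - \int[P']_w f (Z w)| <= e / 4.
  move=> mZ iZ ZC.
  apply: (le_trans (expectation_box_error mZ cf cg fM gM L0 (ltW e8) gf iZ ZC)).
  rewrite (_ : 2 * M / L ^+ 2 * _ = D / L ^+ 2); last by rewrite /D; ring.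
  by lra.
have errnu := err _ _ nu _ mid inu C'ge.
have errX N := err _ _ P _ (mX N) (iX N) (fun i => le_trans (XC N i) CC').
have /cvgrPdist_le/(_ (e / 4)) := tcvg _ tg.
rewrite divr_gt0// => /(_ erefl); apply: filter_app; near=> N => h.
have {}errX := errX N.
change (`|\int[nu]_x f (x : 'cV[R]_k) - \int[P]_w f (X N w)| <= e).
set a := \int[nu]_x f _; set b := \int[P]_w f _.
rewrite -/a in errnu; rewrite -/b in errX.
set a' := \int[nu]_x g _ in errnu h; set b' := \int[P]_w g _ in errX h.
rewrite (_ : a - b = (a' - b') + ((b' - b) - (a' - a))); last by ring.
apply: (le_trans (ler_normD _ _)).
have := ler_normB (b' - b) (a' - a).
by lra.
Unshelve. all: by end_near. Qed.

End levy.

(** * Almost sure convergence from summable expectations *)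

(** Terms of a series of nonnegative functions with a finite total expectation
    tend to [0] almost surely, since the series has finite sum almost surely. *)
Lemma ae_cvg0_summable d (T : measurableType d) (R : realType)
    (P : probability T R) (f : nat -> T -> R) (a : nat -> R) (B : R) :
  (forall n, measurable_fun setT (f n)) -> (forall n w, 0 <= f n w) ->
  (forall n, (\int[P]_w (f n w)%:E <= (a n)%:E)%E) ->
  (forall N, \sum_(0 <= n < N) a n <= B) ->
  {ae P, forall w, f n w @[n --> \oo] --> 0}.
Proof.
move=> mf f0 fa aB.
have mfE n : measurable_fun setT (fun w => (f n w)%:E) by exact/measurable_EFinP.
have f0E n w : (0 <= (f n w)%:E)%E by rewrite lee_fin.
pose g w := (\sum_(n <oo) (f n w)%:E)%E.
have g0 w : (0 <= g w)%E by apply: nneseries_ge0 => n _ _.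
have ig : P.-integrable setT g.
  apply/integrableP; split; first by apply: ge0_emeasurable_sum.
  under eq_integral do rewrite gee0_abs//.
  rewrite integral_nneseries//; apply: (@le_lt_trans _ _ B%:E); last exact: ltry.
  apply: lime_le.
    by apply: is_cvg_nneseries => n _ _; apply: integral_ge0.
  apply: nearW => N; apply: (@le_trans _ _ (\sum_(0 <= n < N) a n)%:E).
    by rewrite -sumEFin; apply: lee_sum => n _.
  by rewrite lee_fin.
have := integrable_ae measurableT ig.
apply: filterS => w /(_ I) gw.
apply: (@cvg_series_cvg_0 _ R^o); apply: nondecreasing_is_cvgn.
  by apply: nondecreasing_series => n _ _.
exists (fine (g w)) => _ [N _ <-].
rewrite -lee_fin fineK// /series/= -sumEFin.
by apply: nneseries_lim_ge => n _ _.
Qed.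

Lemma sum_inv_sqr_le (R : realType) (N : nat) :
  \sum_(0 <= n < N) (n.+1%:R ^+ 2)^-1 <= 2 :> R.
Proof.
suff h : \sum_(0 <= n < N.+1) (n.+1%:R ^+ 2)^-1 <= 2 - N.+1%:R^-1 :> R.
  apply: (@le_trans _ _ (2 - N.+1%:R^-1)); last by rewrite gerBl.
  by apply: le_trans h; rewrite big_nat_recr//= lerDl invr_ge0 sqr_ge0.
elim: N => [|N ih]; first by rewrite big_nat1 expr1n invr1; lra.
rewrite big_nat_recr//=; apply: (le_trans (lerD ih (lexx _))).
have n0 : 0 < N.+1%:R :> R by [].
rewrite -(natr1 N.+1); move: (N.+1%:R : R) n0 => x x0.
rewrite -subr_ge0 (_ : _ - _ = 1 / (x * (x + 1) ^+ 2)).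
  by rewrite divr_ge0// mulr_ge0 ?sqr_ge0// ltW.
have x1 : x + 1 != 0 by rewrite gt_eqF// addr_gt0.
by field; rewrite x1 gt_eqF.
Qed.

(** * The draws of the urn as a Markov chain *)

Section urn.
Context {R : realType} d (T : measurableType d) (P : probability T R) (k : nat).
Variables (alpha : R) (b0 B0 : 'cV[R]_k) (xi : nat -> T -> 'cV[R]_k).
Hypotheses (halpha : 0 < alpha)
  (hurn : rescaled_polya_urn P alpha 0 b0 B0 xi).

Let p0 : 'cV[R]_k := (norm1 b0)^-1 *: b0.
Let gamma : R := alpha / (norm1 b0 + alpha).
Let e (j : 'I_k) : 'cV[R]_k := delta_mx j 0.
Let X (N : nat) (w : T) : 'cV[R]_k :=
  Num.sqrt N%:R *: (draws_mean xi N w - p0).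

(** The first [n] draws take finitely many values, so such a function is a finite
    combination of indicators of cylinders ([adapted_simple]) and is measurable
    and integrable for free. *)
Definition adapted (n : nat) (H : T -> R) := forall w w',
  (forall m, (1 <= m <= n)%N -> xi m w = xi m w') -> H w = H w'.

Let cylinder (n : nat) (i : {ffun 'I_n -> 'I_k}) : set T :=
  [set w | forall m : 'I_n, xi m.+1 w (i m) 0 = 1].

Lemma basis_coord1 (j i : 'I_k) : e j i 0 = (i == j)%:R.
Proof. by rewrite mxE eqxx andbT. Qed.

Lemma draw_coord1 n w i : xi n.+1 w i 0 = 1 -> xi n.+1 w = e i.
Proof.
have [j ->] := urn_draw_basis hurn w (ltn0Sn n).
rewrite mxE eqxx andbT; case: eqP => [->//|_] /eqP.
by rewrite eq_sym oner_eq0.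
Qed.

Lemma cylinder_sigma n i : draws_sigma (xi : nat -> T -> borel_vec R k) n
  (@cylinder n i).
Proof.
pose A := \bigcup_(m in [set m | (1 <= m <= n)%N])
  preimage_set_system setT (xi m : T -> borel_vec R k) measurable.
have -> : cylinder i = \bigcap_(m in [set: 'I_n])
    ((xi m.+1) @^-1` [set x : 'cV[R]_k | x (i m) 0 = 1]).
  by apply/seteqP; split => w h m; [move=> _; exact: h|exact: h m I].
apply: (@fin_bigcap_measurable _ (g_sigma_algebraType A)) => // m _.
apply: sub_sigma_algebra; exists m.+1; first by rewrite /= ltn_ord.
exists [set x : 'cV[R]_k | x (i m) 0 = 1]; last by rewrite setTI.
have mc := measurable_continuous_borel_vec (@coord_continuous R k 1 (i m) 0).
have := mc measurableT [set 1] (measurable_set1 _).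
by rewrite setTI.
Qed.

Lemma measurable_draw_coord n i :
  measurable_fun setT (fun w => xi n.+1 w i 0).
Proof.
have mc := measurable_continuous_borel_vec (@coord_continuous R k 1 i 0).
exact: (measurableT_comp mc (urn_draw_measurable hurn (ltn0Sn n))).
Qed.

Lemma measurable_cylinder n i : measurable (@cylinder n i).
Proof.
rewrite (_ : cylinder i = \bigcap_(m in [set: 'I_n])
    ((fun w => xi m.+1 w (i m) 0) @^-1` [set 1])).
  apply: fin_bigcap_measurable => // m _.
  by rewrite -[X in measurable X]setTI; apply: measurable_draw_coord.
by apply/seteqP; split => w h m; [move=> _; exact: h|exact: h m I].
Qed.

Lemma cylinder_unique n i i' w :
  @cylinder n i w -> cylinder i' w -> i = i'.
Proof.
move=> iw i'w; apply/ffunP => m.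
have := i'w m; rewrite (draw_coord1 (iw m)) basis_coord1.
by case: eqP => [->//|_] /eqP; rewrite eq_sym oner_eq0.
Qed.

Lemma cylinder_exists n w : exists i, @cylinder n i w.
Proof.
have /choice[i iw] : forall m : 'I_n, exists j, xi m.+1 w = e j.
  by move=> m; exact: (urn_draw_basis hurn w (ltn0Sn m)).
by exists [ffun m => i m] => m; rewrite iw ffunE basis_coord1 eqxx.
Qed.

Lemma adapted_simple n (H : T -> R) : adapted n H ->
  exists h : {ffun 'I_n -> 'I_k} -> R,
    H = (fun w => \sum_i h i * \1_(cylinder i) w).
Proof.
move=> aH.
exists (fun i => if pselect (exists w, cylinder i w) is left ex
                 then H (sval (cid ex)) else 0).
apply/funext => w; have [i iw] := cylinder_exists n w.
rewrite (bigD1 i)//= [X in _ + X]big1 ?addr0; last first.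
  move=> i' /eqP i'i; rewrite indicE memNset ?mulr0// => i'w.
  exact/i'i/(cylinder_unique i'w iw).
rewrite indicE mem_set// mulr1; case: pselect => [ex|[]]; last by exists w.
case: cid => w' /= iw'; apply: aH => -[//|m] /andP[_ mn].
by rewrite (draw_coord1 (iw (Ordinal mn))) (draw_coord1 (iw' (Ordinal mn))).
Qed.

Lemma adapted_measurable n H : adapted n H -> measurable_fun setT H.
Proof.
move=> /adapted_simple[h ->]; apply: measurable_sum => i.
apply: measurable_funM => //; apply: measurable_indic.
exact: measurable_cylinder.
Qed.

Lemma adapted_bounded n H : adapted n H -> exists M, forall w, `|H w| <= M.
Proof.
move=> /adapted_simple[h ->]; exists (\sum_i `|h i|) => w.
apply: le_trans (ler_norm_sum _ _ _) _; apply: ler_sum => i _.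
rewrite normrM ler_piMr// indicE.
by case: (_ \in _); rewrite ?normr1 ?normr0.
Qed.

Lemma adapted_integrable n H : adapted n H -> P.-integrable setT (EFin \o H).
Proof.
move=> aH; have [M HM] := adapted_bounded aH.
exact: (bounded_integrable P (adapted_measurable aH) HM).
Qed.

Let psi n w : 'cV[R]_k := urn_psi alpha 0 b0 B0 (fun m => xi m w) n.

Lemma psi_adapted n j : adapted n (fun w => psi n w j 0).
Proof.
move=> w w' ww'; rewrite /psi /urn_psi /urn_N.
suff -> : urn_B alpha 0 B0 (xi^~ w) n = urn_B alpha 0 B0 (xi^~ w') n by [].
elim: n ww' => [//|n ih] ww' /=.
by rewrite ih ?ww' ?ltnSn// => m /andP[m1 mn]; rewrite ww'// m1 ltnW.
Qed.

(** The defining property of conditional probabilities, extended by linearity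
    from cylinders to adapted functions.  The coordinate [j] of a draw is the
    indicator of the event that colour [j] is drawn. *)
Lemma cond_draw n j H : adapted n H ->
  \int[P]_w (H w * xi n.+1 w j 0) = \int[P]_w (H w * psi n w j 0).
Proof.
move=> /adapted_simple[h ->].
have [_ ipsi law] := urn_draw_law hurn n j.
have ind1 i w : \1_(cylinder i) w * xi n.+1 w j 0 =
    \1_([set w | xi n.+1 w j 0 = 1] `&` @cylinder n i) w :> R.
  rewrite indicI /= mulrC; congr (_ * _).
  rewrite indicE; have [x1|x1] := boolP (w \in [set w | xi n.+1 w j 0 = 1]).
    by rewrite inE in x1.
  rewrite notin_setE /= in x1.
  have [l xl] := urn_draw_basis hurn w (ltn0Sn n).
  move: x1; rewrite xl basis_coord1; by case: eqP.
have mA : measurable [set w | xi n.+1 w j 0 = 1].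
  rewrite -[X in measurable X]setTI.
  have m1 := @measurable_draw_coord n j measurableT [set 1] (measurable_set1 _).
  exact: m1.
have mAC i : measurable ([set w | xi n.+1 w j 0 = 1] `&` @cylinder n i).
  by apply: measurableI => //; exact: measurable_cylinder.
have i1 i : P.-integrable setT
    (EFin \o \1_([set w | xi n.+1 w j 0 = 1] `&` @cylinder n i)).
  exact: integrable_indic.
have i2 i : P.-integrable setT
    (EFin \o (fun w => \1_(@cylinder n i) w * psi n w j 0)).
  apply: (@adapted_integrable n) => w w' ww'.
  rewrite (psi_adapted j ww'); congr (_ * _); rewrite !indicE.
  congr (nat_of_bool _)%:R; apply/idP/idP; rewrite !inE => iw m;
    have := iw m; rewrite ww' ?ltn_ord//.
transitivity (\int[P]_w \sum_i
    h i * \1_([set w | xi n.+1 w j 0 = 1] `&` @cylinder n i) w).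
  apply: eq_Rintegral => w _; rewrite mulr_suml.
  by apply: eq_bigr => i _; rewrite -mulrA ind1.
transitivity (\int[P]_w \sum_i h i * (\1_(@cylinder n i) w * psi n w j 0));
  last first.
  apply: eq_Rintegral => w _; rewrite mulr_suml.
  by apply: eq_bigr => i _; rewrite mulrA.
rewrite !Rintegral_finsum; first last.
- by move=> i; exact: (@integrableZl _ _ _ _ _ measurableT (h i) _ (i1 i)).
- by move=> i; exact: (@integrableZl _ _ _ _ _ measurableT (h i) _ (i2 i)).
apply: eq_bigr => i _; rewrite !RintegralZl//; congr (_ * _).
congr fine; rewrite integral_indic// setIT.
apply: etrans (law _ (cylinder_sigma i)) _.
rewrite [LHS]integral_mkcond; apply: eq_integral => w _.
rewrite patchE indicE; case: ifP => _; by rewrite ?mul1r ?mul0r.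
Qed.

Lemma sum_b0 : \sum_i b0 i 0 = norm1 b0.
Proof.
by apply: eq_bigr => i _; rewrite ger0_norm//; exact: (urn_b0_ge0 hurn).
Qed.

Lemma b0_gt0 : 0 < norm1 b0. Proof. exact: (urn_b0_gt0 hurn). Qed.

Lemma p0_ge0 i : 0 <= p0 i 0.
Proof.
by rewrite mxE mulr_ge0 ?invr_ge0 ?(ltW b0_gt0)//; exact: (urn_b0_ge0 hurn).
Qed.

Lemma sum_p0 : \sum_i p0 i 0 = 1.
Proof.
under eq_bigr do rewrite mxE.
by rewrite -mulr_sumr sum_b0 mulVf// gt_eqF// b0_gt0.
Qed.

Lemma gamma_gt0 : 0 < gamma.
Proof. by rewrite divr_gt0// addr_gt0// b0_gt0. Qed.

Lemma gamma_lt1 : gamma < 1.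
Proof.
by rewrite ltr_pdivrMr ?addr_gt0 ?b0_gt0// mul1r ltrDr b0_gt0.
Qed.

Lemma psiE n w : psi n.+1 w = (1 - gamma) *: p0 + gamma *: xi n.+1 w.
Proof.
have [j xj] := urn_draw_basis hurn w (ltn0Sn n).
have b0ge i := urn_b0_ge0 hurn i.
have xge i : 0 <= xi n.+1 w i 0 by rewrite xj basis_coord1 ler0n.
have sx : \sum_i xi n.+1 w i 0 = 1.
  rewrite xj (bigD1 j)//= basis_coord1 eqxx big1 ?addr0// => i ij.
  by rewrite basis_coord1 (negbTE ij).
have nN : norm1 (b0 + alpha *: xi n.+1 w) = norm1 b0 + alpha.
  rewrite /norm1 -[in RHS](mulr1 alpha) -sx mulr_sumr -big_split/=.
  apply: eq_bigr => i _; rewrite !mxE ger0_norm; first by rewrite ger0_norm.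
  by rewrite addr_ge0// mulr_ge0// ltW.
have n0 := b0_gt0.
have n1 : 0 < norm1 b0 + alpha by rewrite addr_gt0.
rewrite /psi /urn_psi /urn_N /= scale0r add0r nN.
apply/matrixP => i l; rewrite (ord1 l) !mxE /gamma.
by field; rewrite !gt_eqF.
Qed.

(** The Markov property: after the first draw, the next draw repeats the
    current one with probability [gamma] and is otherwise drawn afresh from
    [p0]. *)
Lemma next_draw n (G : T -> 'cV[R]_k -> R) :
  (forall x, adapted n.+1 (G^~ x)) ->
  \int[P]_w G w (xi n.+2 w) =
  \int[P]_w ((1 - gamma) * (\sum_j p0 j 0 * G w (e j))
             + gamma * G w (xi n.+1 w)).
Proof.
move=> aG.
have sel m w : G w (xi m.+1 w) = \sum_j G w (e j) * xi m.+1 w j 0.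
  have [l xl] := urn_draw_basis hurn w (ltn0Sn m).
  rewrite xl (bigD1 l)//= basis_coord1 eqxx mulr1 big1 ?addr0// => i il.
  by rewrite basis_coord1 (negbTE il) mulr0.
have aGe j := aG (e j).
transitivity (\int[P]_w \sum_j G w (e j) * xi n.+2 w j 0).
  by apply: eq_Rintegral => w _; exact: sel.
rewrite Rintegral_finsum; last first.
  move=> j; apply: (@adapted_integrable n.+2) => w w' ww'.
  congr (_ * _); last by rewrite ww'// leqnn.
  by apply: aGe => m /andP[m1 mn]; rewrite ww'// m1 ltnW.
under eq_bigr do rewrite cond_draw//.
rewrite -Rintegral_finsum; last first.
  move=> j; apply: (@adapted_integrable n.+1) => w w' ww'.
  by congr (_ * _); [exact: aGe|exact: psi_adapted].
apply: eq_Rintegral => w _; rewrite sel !mulr_sumr -big_split/=.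
by apply: eq_bigr => j _; rewrite psiE !mxE; ring.
Qed.

(** * The martingale attached to a linear form *)

Section linear_statistic.
Variable t : 'cV[R]_k.

Let y (x : 'cV[R]_k) : R := (t^T *m (x - p0)) 0 0.
(* The variance of the linear form under [p0]. *)
Let q : R := \sum_j p0 j 0 * y (e j) ^+ 2.
Let c : R := \sum_j `|y (e j)|.

Lemma mean_y : \sum_j p0 j 0 * y (e j) = 0.
Proof.
have -> : \sum_j p0 j 0 * y (e j) =
    (t^T *m (\sum_j p0 j 0 *: (e j - p0))) 0 0.
  rewrite mulmx_sumr summxE; apply: eq_bigr => j _.
  by rewrite -scalemxAr [RHS]mxE.
rewrite (_ : \sum_j _ = 0) ?mulmx0 ?mxE//.
apply/matrixP => i l; rewrite (ord1 l) summxE mxE.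
under eq_bigr do rewrite mxE [X in _ * X]mxE [in X in _ + X]mxE mulrBr basis_coord1.
rewrite sumrB -mulr_suml sum_p0 mul1r (bigD1 i)//= eqxx mulr1 big1 ?addr0 ?subrr//.
by move=> j /negbTE; rewrite eq_sym => ->; rewrite mulr0.
Qed.

Lemma q_ge0 : 0 <= q.
Proof. by apply: sumr_ge0 => j _; rewrite mulr_ge0 ?p0_ge0 ?sqr_ge0. Qed.

Lemma c_ge0 : 0 <= c. Proof. exact: sumr_ge0. Qed.

Lemma y_le j : `|y (e j)| <= c.
Proof. by rewrite /c (bigD1 j)//= lerDl sumr_ge0. Qed.

Lemma draw_basis n w : exists j, xi n.+1 w = e j.
Proof. exact: (urn_draw_basis hurn w (ltn0Sn n)). Qed.

Lemma y_draw_le n w : `|y (xi n.+1 w)| <= c.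
Proof. by have [j ->] := draw_basis n w; exact: y_le. Qed.

(* The expectation of [g] at draw [n.+2], given the first [n.+1] draws. *)
Let avg n w (g : 'cV[R]_k -> R) : R :=
  (1 - gamma) * (\sum_j p0 j 0 * g (e j)) + gamma * g (xi n.+1 w).
(* The increment of the martingale when draw [n.+2] takes the value [x]. *)
Let dev n w x : R := y x - gamma * y (xi n.+1 w).
(* Centred under [p0], so that one step of the chain multiplies it by [gamma]. *)
Let h x : R := y x ^+ 2 - q.

(** The first two conditional moments of the increment and the conditional mean
    of [h], in one formula: [dev] is centred, which is the martingale property,
    and its conditional variance is [(1 - gamma ^ 2) q] plus a multiple of [h]
    at the current draw. *)
Lemma avg_quadratic n w (A B C D : R) :
  avg n w (fun x => A + B * dev n w x + C * dev n w x ^+ 2 + D * h x) =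
  A + C * ((1 - gamma ^+ 2) * q + gamma * (1 - gamma) * h (xi n.+1 w))
  + D * (gamma * h (xi n.+1 w)).
Proof.
set z := y (xi n.+1 w).
have -> : avg n w (fun x => A + B * dev n w x + C * dev n w x ^+ 2 + D * h x) =
    (1 - gamma) * ((A - B * (gamma * z) + C * (gamma * z) ^+ 2 - D * q) * \sum_j p0 j 0 +
      (B - 2 * C * gamma * z) * \sum_j p0 j 0 * y (e j) +
      (C + D) * \sum_j p0 j 0 * y (e j) ^+ 2) +
    gamma * (A + B * ((1 - gamma) * z) + C * ((1 - gamma) * z) ^+ 2
      + D * (z ^+ 2 - q)).
  rewrite /avg /dev /h -/z; move: z (q) => z q0; congr (_ * _ + _ * _); last by ring.
  by rewrite !mulr_sumr -!big_split/=; apply: eq_bigr => j _; ring.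
by rewrite sum_p0 mean_y -/q /h -/z; ring.
Qed.

Lemma avg_dist n w (f g : 'cV[R]_k -> R) (E : R) :
  (forall j, `|f (e j) - g (e j)| <= E) -> `|avg n w f - avg n w g| <= E.
Proof.
move=> fg; rewrite /avg; have [l ->] := draw_basis n w.
have g0 := gamma_gt0; have g1 := gamma_lt1.
move: (gamma) g0 g1 => ga g0 g1.
rewrite (_ : _ - _ = (1 - ga) * (\sum_j p0 j 0 * (f (e j) - g (e j)))
                    + ga * (f (e l) - g (e l))); last first.
  under [in RHS]eq_bigr do rewrite mulrBr.
  by rewrite sumrB; ring.
apply: (le_trans (ler_normD _ _)); rewrite !normrM.
rewrite (gtr0_norm g0) (gtr0_norm (_ : 0 < 1 - ga)) ?subr_gt0//.
rewrite [leRHS](_ : _ = (1 - ga) * E + ga * E); last by ring.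
apply: lerD; rewrite ler_wpM2l ?subr_ge0 ?(ltW g0) ?(ltW g1)//.
apply: le_trans (ler_norm_sum _ _ _) _.
rewrite -[leRHS]mul1r -sum_p0 mulr_suml; apply: ler_sum => j _.
by rewrite normrM ger0_norm ?p0_ge0// ler_wpM2l ?p0_ge0.
Qed.

Lemma avg_le n w (f g : 'cV[R]_k -> R) :
  (forall j, f (e j) <= g (e j)) -> avg n w f <= avg n w g.
Proof.
move=> fg; rewrite /avg; have [l ->] := draw_basis n w.
have g0 := gamma_gt0; have g1 := gamma_lt1.
apply: lerD; rewrite ler_wpM2l ?subr_ge0 ?(ltW g0) ?(ltW g1)//.
by apply: ler_sum => j _; rewrite ler_wpM2l ?p0_ge0.
Qed.

Lemma dev_le n w j : `|dev n w (e j)| <= 2 * c.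
Proof.
apply: (le_trans (ler_normB _ _)); rewrite normrM.
have g0 := gamma_gt0; have g1 := gamma_lt1.
move: (gamma) g0 g1 => ga g0 g1; rewrite (gtr0_norm g0).
have h1 := y_le j; have h2 := y_draw_le n w.
have h3 : ga * `|y (xi n.+1 w)| <= 1 * c by rewrite ler_pM// ltW.
by lra.
Qed.

(* [M n] is the martingale at time [n.+1]: its argument counts the steps after
   the first draw, whose law depends on the initial urn. *)
Let S n w : R := \sum_(m < n) y (xi m.+1 w).
Let M n w : R := (1 - gamma) * S n.+1 w + gamma * y (xi n.+1 w).

Lemma M_succ n w : M n.+1 w = M n w + dev n w (xi n.+2 w).
Proof. by rewrite /M /S big_ord_recr/= /dev; ring. Qed.

Lemma S_adapted n : adapted n (S n).
Proof.
by move=> w w' ww'; apply: eq_bigr => m _; rewrite ww'//= ltn_ord.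
Qed.

Lemma M_adapted n : adapted n.+1 (M n).
Proof.
move=> w w' ww'; congr (_ * _ + _ * _); first exact: S_adapted.
by rewrite ww'// leqnn.
Qed.

Lemma next_M n (F : R -> 'cV[R]_k -> R) :
  \int[P]_w F (M n.+1 w) (xi n.+2 w) =
  \int[P]_w avg n w (fun x => F (M n w + dev n w x) x).
Proof.
have := @next_draw n (fun w x => F (M n w + dev n w x) x).
rewrite /avg => <-; first by apply: eq_Rintegral => w _; rewrite M_succ.
move=> x w w' ww'; rewrite (M_adapted ww') /dev.
by rewrite (ww' n.+1)// leqnn.
Qed.

Let pow_adapted m n : adapted n.+1 (fun w => M n w ^+ m).
Proof. by move=> w w' ww'; rewrite (M_adapted ww'). Qed.

Let int_pow m n : P.-integrable setT (EFin \o (fun w => M n w ^+ m)).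
Proof. exact: adapted_integrable (@pow_adapted m n). Qed.

Lemma avg_adapted n (F : R -> 'cV[R]_k -> R) :
  adapted n.+1 (fun w => avg n w (fun x => F (M n w + dev n w x) x)).
Proof.
move=> w w' ww'; rewrite /avg /dev.
rewrite (ww' n.+1) ?leqnn//.
by rewrite (M_adapted ww').
Qed.

(** Increments of a martingale are orthogonal, and here they are bounded by
    [2 c]. *)
Lemma second_moment_M n :
  \int[P]_w M n w ^+ 2 <= (2 * c) ^+ 2 * n.+1%:R.
Proof.
have c0 := c_ge0.
have ic (r : R) : P.-integrable setT (EFin \o cst r).
  exact: finite_measure_integrable_cst.
elim: n => [|n ih].
  rewrite mulr1 -[leRHS](Rintegral_probability_cst P); apply: le_Rintegral => //.
  move=> w _ /=; rewrite /M /S big_ord1.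
  rewrite (_ : _ + _ = y (xi 1 w)); last by ring.
  rewrite -[leLHS]real_normK ?num_real// ler_sqr ?nnegrE ?mulr_ge0//.
  by apply: (le_trans (y_draw_le 0 w)); lra.
rewrite (@next_M n (fun u _ => u ^+ 2)).
apply: (@le_trans _ _ (\int[P]_w (M n w ^+ 2 + cst ((2 * c) ^+ 2) w))).
  apply: le_Rintegral => //.
  - exact: adapted_integrable (avg_adapted (n := n) (fun u _ => u ^+ 2)).
  - exact: (@integrableD _ _ _ _ _ measurableT _ _ (int_pow 2 n) (ic _)).
  move=> w _ /=.
  apply: (@le_trans _ _ (avg n w (fun x => (M n w ^+ 2 + (2 * c) ^+ 2)
    + 2 * M n w * dev n w x + 0 * dev n w x ^+ 2 + 0 * h x))).
    apply: avg_le => j; have := dev_le n w j.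
    have : dev n w (e j) ^+ 2 = `|dev n w (e j)| ^+ 2 by rewrite real_normK ?num_real.
    move=> h1 h2.
    have : dev n w (e j) ^+ 2 <= (2 * c) ^+ 2.
      by rewrite h1 ler_sqr ?nnegrE ?mulr_ge0.
    move: (M n w) (dev n w (e j)) => u v vD.
    rewrite !mul0r !addr0 (_ : (u + v) ^+ 2 = u ^+ 2 + 2 * u * v + v ^+ 2).
      by lra.
    by ring.
  by rewrite avg_quadratic !mul0r !addr0.
rewrite RintegralD// Rintegral_probability_cst.
by rewrite -(natr1 n.+1) mulrDr mulr1 lerD2r.
Qed.

(** In the expansion of [(M + dev) ^ 4] the term linear in [dev] has conditional
    mean [0], and the cubic one is absorbed by the others through
    [4 u v ^ 3 <= 4 u ^ 2 v ^ 2 + v ^ 4]; the second moment bound then makes the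
    increase linear in [n]. *)
Lemma fourth_moment_M n :
  \int[P]_w M n w ^+ 4 <= 6 * (2 * c) ^+ 4 * n.+1%:R ^+ 2.
Proof.
have c0 := c_ge0.
have ic (r : R) : P.-integrable setT (EFin \o cst r).
  exact: finite_measure_integrable_cst.
set D := (2 * c) ^+ 2.
have D0 : 0 <= D by exact: sqr_ge0.
have -> : (2 * c) ^+ 4 = D ^+ 2 by rewrite /D -exprM.
elim: n => [|n ih].
  rewrite expr1n mulr1 -[leRHS](Rintegral_probability_cst P).
  apply: le_Rintegral => // w _ /=; rewrite /M /S big_ord1.
  rewrite (_ : _ + _ = y (xi 1 w)); last by ring.
  have h1 : y (xi 1 w) ^+ 2 <= D.
    rewrite -[leLHS]real_normK ?num_real// ler_sqr ?nnegrE ?mulr_ge0//.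
    by apply: (le_trans (y_draw_le 0 w)); lra.
  have h2 : (y (xi 1 w) ^+ 2) ^+ 2 <= D ^+ 2 by rewrite ler_sqr ?nnegrE ?sqr_ge0.
  have h3 : 0 <= D ^+ 2 by exact: sqr_ge0.
  have -> : y (xi 1 w) ^+ 4 = (y (xi 1 w) ^+ 2) ^+ 2 by rewrite -exprM.
  by lra.
rewrite (@next_M n (fun u _ => u ^+ 4)).
have i10 : P.-integrable setT (EFin \o (fun w => 10 * D * M n w ^+ 2)).
  exact: (@integrableZl _ _ _ _ _ measurableT (10 * D) _ (int_pow 2 n)).
have i10c : P.-integrable setT
    (EFin \o (fun w => 10 * D * M n w ^+ 2 + cst (2 * D ^+ 2) w)).
  exact: (@integrableD _ _ _ _ _ measurableT _ _ i10 (ic _)).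
apply: (@le_trans _ _
    (\int[P]_w (M n w ^+ 4 + (10 * D * M n w ^+ 2 + cst (2 * D ^+ 2) w)))).
  apply: le_Rintegral => //.
  - exact: adapted_integrable (avg_adapted (n := n) (fun u _ => u ^+ 4)).
  - exact: (@integrableD _ _ _ _ _ measurableT _ _ (int_pow 4 n) i10c).
  move=> w _ /=.
  apply: (@le_trans _ _ (avg n w (fun x =>
    (M n w ^+ 4 + (10 * D * M n w ^+ 2 + 2 * D ^+ 2))
    + 4 * M n w ^+ 3 * dev n w x + 0 * dev n w x ^+ 2 + 0 * h x))).
    apply: avg_le => j; have dl := dev_le n w j.
    move: (M n w) (dev n w (e j)) dl => u v dl.
    have v2 : v ^+ 2 <= D.
      by rewrite -[leLHS]real_normK ?num_real// ler_sqr ?nnegrE ?mulr_ge0.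
    have v4 : v ^+ 4 <= D ^+ 2.
      have -> : v ^+ 4 = (v ^+ 2) ^+ 2 by rewrite -exprM.
      by rewrite ler_sqr ?nnegrE ?sqr_ge0.
    have uv : u ^+ 2 * v ^+ 2 <= u ^+ 2 * D by rewrite ler_wpM2l ?sqr_ge0.
    have : 0 <= (2 * (u * v) - v ^+ 2) ^+ 2 by exact: sqr_ge0.
    rewrite (_ : (2 * (u * v) - v ^+ 2) ^+ 2 =
      4 * (u ^+ 2 * v ^+ 2) - 4 * (u * v ^+ 3) + v ^+ 4); last by ring.
    rewrite (_ : (u + v) ^+ 4 = u ^+ 4 + 4 * (u ^+ 3 * v)
      + 6 * (u ^+ 2 * v ^+ 2) + 4 * (u * v ^+ 3) + v ^+ 4); last by ring.
    move=> h0; lra.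
  by rewrite avg_quadratic !mul0r !addr0.
rewrite RintegralD// RintegralD// Rintegral_probability_cst RintegralZl//.
have m2 := ler_wpM2l (mulr_ge0 (ler0n R 10) D0) (second_moment_M n).
rewrite -/D in m2.
have n0 : 0 <= n.+1%:R :> R by [].
rewrite -(natr1 n.+1); move: (n.+1%:R : R) ih m2 n0 => N ih m2 N0.
have D2 : 0 <= D ^+ 2 by exact: sqr_ge0.
have D2N : 0 <= D ^+ 2 * N by rewrite mulr_ge0.
rewrite (_ : 6 * D ^+ 2 * (N + 1) ^+ 2 =
  6 * D ^+ 2 * N ^+ 2 + (12 * (D ^+ 2 * N) + 6 * D ^+ 2)); last by ring.
apply: lerD => //.
rewrite (_ : 10 * D * (D * N) = 10 * (D ^+ 2 * N)) in m2; last by ring.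
by lra.
Qed.

(** * Perturbed characters and the central limit theorem for a linear form *)
(* The mean under [p0] of the conditional variance of the increments. *)
Let vbar : R := (1 - gamma ^+ 2) * q.
Let H : R := c ^+ 2 + q.

Lemma vbar_ge0 : 0 <= vbar.
Proof.
have g0 := gamma_gt0; have g1 := gamma_lt1.
by rewrite mulr_ge0 ?q_ge0// subr_ge0 expr_le1 ?ltW.
Qed.

Lemma H_ge0 : 0 <= H.
Proof. by rewrite addr_ge0 ?sqr_ge0 ?q_ge0. Qed.

Lemma h_draw_le n w : `|h (xi n.+1 w)| <= H.
Proof.
apply: (le_trans (ler_normB _ _)).
rewrite (ger0_norm q_ge0) lerD2r ger0_norm ?sqr_ge0//.
by rewrite -[leLHS]real_normK ?num_real// ler_sqr ?nnegrE ?c_ge0// y_draw_le.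
Qed.

Lemma h_le j : `|h (e j)| <= H.
Proof.
apply: (le_trans (ler_normB _ _)).
rewrite (ger0_norm q_ge0) lerD2r ger0_norm ?sqr_ge0//.
by rewrite -[leLHS]real_normK ?num_real// ler_sqr ?nnegrE ?c_ge0// y_le.
Qed.

(** The corrector [- (s ^ 2 * gamma / 2) * h] absorbs the fluctuation of the
    conditional variance of the martingale, so that the conditional expectation
    of [Phi] is a constant multiple of [Phi] up to order [s ^ 3]. *)
Let F (th s u : R) (x : 'cV[R]_k) : R :=
  cos (th + s * u) * (1 - s ^+ 2 * gamma / 2 * h x).
Let Phi (th s : R) n w : R := F th s (M n w) (xi n.+1 w).

(** The approximating expression is quadratic in [dev] and linear in [h], so that
    [avg_quadratic] gives its conditional expectation exactly. *)
Lemma avg_F_error (th s ph a : R) n w j : 0 <= s <= 1 ->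
  ph = th + s * M n w -> a = s ^+ 2 * gamma / 2 ->
  `|F th s (M n w + dev n w (e j)) (e j) -
    (cos ph + (- (s * sin ph)) * dev n w (e j) +
     (- (s ^+ 2 / 2 * cos ph)) * dev n w (e j) ^+ 2 +
     (- (a * cos ph)) * h (e j))|
  <= ((2 * c) ^+ 3 + (2 * c) ^+ 4 + H * c) * s ^+ 3.
Proof.
move=> /andP[s0 s1] phE aE; have dl := dev_le n w j; have hl := h_le j.
rewrite /F (_ : th + s * (M n w + dev n w (e j)) = ph + s * dev n w (e j));
  last by rewrite phE; ring.
rewrite -aE.
have a0 : 0 <= a by rewrite aE divr_ge0// mulr_ge0 ?sqr_ge0// ltW ?gamma_gt0.
have a1 : a <= s ^+ 2 / 2.
  by rewrite aE ler_pM2r// ler_piMr ?sqr_ge0// ltW ?gamma_lt1.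
have c0 := c_ge0; have H0 := H_ge0.
move: (dev n w (e j)) (h (e j)) dl hl => v b dl hl.
have sv : `|s * v| <= s * (2 * c).
  by rewrite normrM ger0_norm// ler_wpM2l.
rewrite (_ : _ - _ =
  (cos (ph + s * v) -
     (cos ph - (s * v) * sin ph - (s * v) ^+ 2 / 2 * cos ph)) -
  a * b * (cos (ph + s * v) - cos ph)); last by ring.
apply: (le_trans (ler_normB _ _)).
have t1 := cos_taylor_at ph (s * v).
have t2 := cos_lip ph (s * v).
have t3 : `|a * b * (cos (ph + s * v) - cos ph)| <=
    (s ^+ 2 / 2 * H) * (s * (2 * c)).
  rewrite normrM; apply: ler_pM => //; last exact: (le_trans t2 sv).
  by rewrite normrM (ger0_norm a0); apply: ler_pM.
have t4 : `|s * v| ^+ 3 <= (s * (2 * c)) ^+ 3.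
  by apply: lerXn2r; rewrite ?nnegrE ?mulr_ge0.
have t5 : (s * v) ^+ 4 <= (2 * c) ^+ 4 * s ^+ 3.
  rewrite (_ : (s * v) ^+ 4 = `|s * v| ^+ 4); last first.
    by rewrite -normrX ger0_norm// exprn_even_ge0.
  apply: (@le_trans _ _ ((s * (2 * c)) ^+ 4)).
    by apply: lerXn2r; rewrite ?nnegrE ?mulr_ge0.
  rewrite exprMn mulrC ler_wpM2l ?exprn_ge0 ?mulr_ge0//.
  by rewrite exprS ler_piMl ?exprn_ge0.
rewrite (_ : (s * (2 * c)) ^+ 3 = (2 * c) ^+ 3 * s ^+ 3) in t4; last by ring.
rewrite (_ : (s ^+ 2 / 2 * H) * (s * (2 * c)) = H * c * s ^+ 3) in t3; last by field.
apply: (le_trans (lerD (le_trans t1 (lerD t4 t5)) t3)).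
by rewrite -!mulrDl.
Qed.

(** After [avg_quadratic], the coefficient of [h] in the conditional expectation
    is [- (s ^ 2 / 2) * gamma * (1 - gamma) - (s ^ 2 * gamma / 2) * gamma], which
    equals [- s ^ 2 * gamma / 2]: the corrector reproduces itself, and the
    remaining factor [1 - s ^ 2 * vbar / 2] agrees with [gauss_char] to order
    [s ^ 4]. *)
Lemma Phi_step : exists2 K : R, 0 <= K & forall (th s : R) n, 0 <= s <= 1 ->
  `|\int[P]_w Phi th s n.+1 w
    - gauss_char (s ^+ 2 * vbar) * \int[P]_w Phi th s n w| <= K * s ^+ 3.
Proof.
have [Kg Kg0 KgP] := @gauss_char_expansion R.
have c0 := c_ge0; have H0 := H_ge0; have v0 := vbar_ge0.
pose K1 := (2 * c) ^+ 3 + (2 * c) ^+ 4 + H * c.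
pose K2 := Kg * vbar ^+ 2 * (1 + H) + H * vbar.
have K10 : 0 <= K1.
  by apply: addr_ge0; [apply: addr_ge0; exact/exprn_ge0/mulr_ge0|exact: mulr_ge0].
have H10 : 0 <= 1 + H by exact: addr_ge0.
have K20 : 0 <= K2.
  apply: addr_ge0; last exact: mulr_ge0.
  by apply: mulr_ge0 => //; apply: mulr_ge0 => //; exact: sqr_ge0.
exists (K1 + K2); first exact: addr_ge0.
move=> th s n s01; have /andP[s0 s1] := s01.
set G := gauss_char _.
have aF := @avg_adapted n (F th s).
have aPhi : adapted n.+1 (Phi th s n).
  by move=> w w' ww'; rewrite /Phi (M_adapted ww') (ww' n.+1)// leqnn.
have iPhi := adapted_integrable aPhi.
have iGPhi : P.-integrable setT (EFin \o (fun w => G * Phi th s n w)).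
  exact: (@integrableZl _ _ _ _ _ measurableT G _ iPhi).
have iF := adapted_integrable aF.
rewrite -RintegralZl// (@next_M n (F th s)) -RintegralB//.
have iB := @integrableB _ _ _ _ _ measurableT _ _ iF iGPhi.
apply: (le_trans (le_normr_Rintegral measurableT iB)).
rewrite -[leRHS](Rintegral_probability_cst P); apply: le_Rintegral => //.
- exact: (integrable_norm iB).
- exact: finite_measure_integrable_cst.
move=> w _ /=.
pose ph := th + s * M n w; pose a := s ^+ 2 * gamma / 2.
pose g x := cos ph + (- (s * sin ph)) * dev n w x +
  (- (s ^+ 2 / 2 * cos ph)) * dev n w x ^+ 2 + (- (a * cos ph)) * h x.
have e1 : `|avg n w (fun x => F th s (M n w + dev n w x) x) - avg n w g|
    <= K1 * s ^+ 3.
  by apply: avg_dist => j; exact: avg_F_error.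
have e2 : `|avg n w g - G * Phi th s n w| <= K2 * s ^+ 3.
  rewrite /g avg_quadratic /Phi /F -/ph -/a.
  have hl := h_draw_le n w.
  have a0 : 0 <= a by rewrite divr_ge0// mulr_ge0 ?sqr_ge0// ltW ?gamma_gt0.
  have a1 : a <= s ^+ 2 / 2.
    by rewrite /a ler_pM2r// ler_piMr ?sqr_ge0// ltW ?gamma_lt1.
  set b := h (xi n.+1 w).
  rewrite (_ : _ - _ = cos ph *
    ((1 - s ^+ 2 * vbar / 2 - G) * (1 - a * b) - a * b * (s ^+ 2 * vbar / 2)));
    last by rewrite /a /vbar; field.
  have G1 : `|1 - s ^+ 2 * vbar / 2 - G| <= Kg * (s ^+ 2 * vbar) ^+ 2.
    by rewrite distrC; apply: KgP; rewrite mulr_ge0 ?sqr_ge0.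
  have s21 : s ^+ 2 <= 1 by rewrite expr_le1.
  have s43 : s ^+ 4 <= s ^+ 3 by rewrite exprS ler_piMl ?exprn_ge0.
  have s4 : 0 <= s ^+ 4 by rewrite exprn_ge0.
  have ab : `|a * b| <= s ^+ 2 * H.
    rewrite normrM (ger0_norm a0); apply: ler_pM => //.
    by apply: (le_trans a1); have := sqr_ge0 s; lra.
  have ab1 : `|1 - a * b| <= 1 + H.
    apply: (le_trans (ler_normB _ _)); rewrite normr1 lerD2l.
    by apply: (le_trans ab); rewrite ler_piMl.
  rewrite normrM; apply: (@le_trans _ _ (1 * (Kg * (s ^+ 2 * vbar) ^+ 2 * (1 + H)
      + s ^+ 2 * H * (s ^+ 2 * vbar)))); last first.
    rewrite mul1r (_ : _ + _ = K2 * s ^+ 4); last by rewrite /K2; ring.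
    exact: ler_wpM2l.
  apply: ler_pM => //; first exact: abs_cos_le1.
  have sv0 : 0 <= s ^+ 2 * vbar by apply: mulr_ge0 => //; exact: sqr_ge0.
  apply: (le_trans (ler_normB _ _)).
  rewrite (normrM (1 - s ^+ 2 * vbar / 2 - G) (1 - a * b)).
  rewrite (normrM (a * b) (s ^+ 2 * vbar / 2)).
  apply: lerD; apply: ler_pM => //.
  rewrite ger0_norm; last by rewrite divr_ge0.
  by rewrite ler_pdivrMr// ler_peMr// ler1n.
have := ler_normD (avg n w (fun x => F th s (M n w + dev n w x) x) - avg n w g)
  (avg n w g - G * Phi th s n w).
by rewrite subrKA mulrDl; lra.
Qed.

(** The one-step errors add up, [gauss_char] being at most [1] in modulus. *)
Lemma Phi_iter : exists2 K : R, 0 <= K & forall (th s : R) n, 0 <= s <= 1 ->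
  `|\int[P]_w Phi th s n w
    - gauss_char (s ^+ 2 * vbar) ^+ n * \int[P]_w Phi th s 0 w|
  <= n%:R * (K * s ^+ 3).
Proof.
have [K K0 KP] := Phi_step; exists K => // th s n s01.
elim: n => [|n ih]; first by rewrite expr0 mul1r subrr normr0 mul0r.
set G := gauss_char _ in ih *.
have G1 : `|G| <= 1 by exact: gauss_char_le1.
have st := KP th s n s01; rewrite -/G in st.
move: ih st; set I1 := \int[P]_w Phi _ _ n.+1 w; set I2 := \int[P]_w Phi _ _ n w.
set I0 := \int[P]_w _ => ih st.
rewrite (_ : I1 - G ^+ n.+1 * I0 = (I1 - G * I2) + G * (I2 - G ^+ n * I0)); last first.
  by rewrite exprS; ring.
apply: (le_trans (ler_normD _ _)); rewrite normrM.
rewrite -(natr1 n) mulrDl mul1r [leRHS]addrC; apply: lerD => //.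
by rewrite -[leRHS]mul1r; apply: ler_pM.
Qed.

(** The hypothesis on [r] says that [s * M n] and [r] differ by the boundary term
    of the martingale. *)
Lemma Phi_cos_error (th s r : R) n w : 0 <= s -> s <= 1 ->
  s * M n w = r + s * (gamma * y (xi n.+1 w)) ->
  `|Phi th s n w - cos (th + r)| <= (c + H) * s.
Proof.
move=> s0 s1 sM; have c0 := c_ge0; have H0 := H_ge0.
have yl := y_draw_le n w; have hl := h_draw_le n w.
have g0 := gamma_gt0; have g1 := gamma_lt1.
rewrite /Phi /F sM addrA.
move: (gamma) g0 g1 (y _) yl (h _) hl => g g0 g1 z zl b bl.
set x := th + r.
rewrite (_ : _ - _ = (cos (x + s * (g * z)) - cos x) -
  cos (x + s * (g * z)) * (s ^+ 2 * g / 2 * b)); last by ring.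
have t1 := cos_lip x (s * (g * z)).
have t2 : `|s * (g * z)| <= s * c.
  rewrite !normrM (ger0_norm s0) (gtr0_norm g0) ler_wpM2l//.
  by rewrite -[leRHS]mul1r; apply: ler_pM => //; exact: ltW.
have t3 : `|cos (x + s * (g * z)) * (s ^+ 2 * g / 2 * b)| <= 1 * (s * H).
  rewrite normrM; apply: ler_pM => //; first exact: abs_cos_le1.
  rewrite normrM; apply: ler_pM => //.
  have gs : s ^+ 2 * g <= s.
    rewrite expr2 -mulrA -[leRHS]mulr1 ler_wpM2l//.
    by rewrite -[leRHS]mulr1; apply: ler_pM => //; exact: ltW.
  rewrite ger0_norm; last by rewrite !mulr_ge0 ?sqr_ge0// ltW.
  by have : 0 <= s ^+ 2 * g by [rewrite mulr_ge0 ?sqr_ge0// ltW]; lra.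
apply: (le_trans (ler_normB _ _)); apply: (le_trans (lerD (le_trans t1 t2) t3)).
by rewrite mul1r -mulrDr mulrC.
Qed.

(* The limiting variance: [vbar] divided by [(1 - gamma) ^+ 2]. *)
Let vlim : R := (1 + gamma) / (1 - gamma) * q.

(** This value of [s] makes [n.+1%:R * (s ^+ 2 * vbar)] equal to [vlim] for every
    [n], so that [n.+1] factors multiply to [gauss_char vlim] exactly.  The
    recursion supplies [n] of them, and the missing one is [1 + O(s ^ 2)]. *)
Lemma char_S_error : exists2 K : R, 0 <= K & forall (th : R) n,
  let s := ((1 - gamma) * Num.sqrt n.+1%:R)^-1 in s <= 1 ->
  `|\int[P]_w cos (th + (Num.sqrt n.+1%:R)^-1 * S n.+1 w)
    - cos th * gauss_char vlim| <= K * s.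
Proof.
have [Kg Kg0 KgP] := @gauss_char_expansion R.
have [K K0 KP] := Phi_iter.
have c0 := c_ge0; have H0 := H_ge0; have v0 := vbar_ge0.
have g0 := gamma_gt0; have g1 := gamma_lt1.
have og0 : 0 < 1 - gamma by rewrite subr_gt0.
pose B := c + H; have Bge : 0 <= B by exact: addr_ge0.
pose K3 := vbar + Kg * vbar ^+ 2.
have K30 : 0 <= K3.
  by apply: addr_ge0 => //; apply: mulr_ge0 => //; exact: sqr_ge0.
have K40 : 0 <= K / (1 - gamma) ^+ 2.
  by apply: divr_ge0 => //; exact: sqr_ge0.
exists (2 * B + K / (1 - gamma) ^+ 2 + K3).
  by apply: addr_ge0 => //; apply: addr_ge0 => //; exact: mulr_ge0.
move=> th n s s1.
have N0 : 0 < Num.sqrt n.+1%:R :> R by rewrite sqrtr_gt0.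
have s0 : 0 < s by rewrite invr_gt0 mulr_gt0.
have Ns2 : n.+1%:R * s ^+ 2 = ((1 - gamma) ^+ 2)^-1.
  rewrite /s exprVn exprMn sqr_sqrtr// invfM mulrCA divff ?mulr1//.
have vlimE : vlim = n.+1%:R * (s ^+ 2 * vbar).
  by rewrite mulrA Ns2 /vlim /vbar; field; rewrite gt_eqF.
rewrite vlimE gauss_char_natmul; last by apply: mulr_ge0 => //; exact: sqr_ge0.
have Kn := KP th s n; rewrite (ltW s0) s1 in Kn; have {}Kn := Kn isT.
set G := gauss_char _ in Kn *.
have Gn1 m : `|G ^+ m| <= 1 by rewrite normrX exprn_ile1// gauss_char_le1.
have aPhi m : adapted m.+1 (Phi th s m).
  by move=> w w' ww'; rewrite /Phi (M_adapted ww') (ww' m.+1)// leqnn.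
have iPhi m := adapted_integrable (aPhi m).
have iC : P.-integrable setT
    (EFin \o (fun w => cos (th + (Num.sqrt n.+1%:R)^-1 * S n.+1 w))).
  by apply: (@adapted_integrable n.+1) => w w' ww'; rewrite (S_adapted ww').
have ic (r : R) : P.-integrable setT (EFin \o cst r).
  exact: finite_measure_integrable_cst.
have e1 : `|\int[P]_w Phi th s n w -
    \int[P]_w cos (th + (Num.sqrt n.+1%:R)^-1 * S n.+1 w)| <= B * s.
  rewrite -RintegralB//.
  have iB := @integrableB _ _ _ _ _ measurableT _ _ (iPhi n) iC.
  apply: (le_trans (le_normr_Rintegral measurableT iB)).
  rewrite -[leRHS](Rintegral_probability_cst P); apply: le_Rintegral => //.
    exact: (integrable_norm iB).
  move=> w _ /=; apply: Phi_cos_error => //; first exact: ltW.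
  rewrite /M mulrDr; congr (_ + _); rewrite /s invfM mulrACA mulVf ?mul1r//.
  by rewrite gt_eqF.
have e2 : `|\int[P]_w Phi th s 0 w - cos th| <= B * s.
  rewrite -[X in _ - X](Rintegral_probability_cst P) -RintegralB//.
  have iB := @integrableB _ _ _ _ _ measurableT _ _ (iPhi 0) (ic (cos th)).
  apply: (le_trans (le_normr_Rintegral measurableT iB)).
  rewrite -[leRHS](Rintegral_probability_cst P); apply: le_Rintegral => //.
    exact: (integrable_norm iB).
  move=> w _ /=.
  have yl := y_draw_le 0 w; have hl := h_draw_le 0 w.
  rewrite /Phi /F /M /S big_ord1.
  rewrite (_ : (1 - gamma) * _ + _ = y (xi 1 w)); last by ring.
  move: (y _) yl (h _) hl => z zl b bl.
  rewrite (_ : _ - _ = (cos (th + s * z) - cos th) -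
    cos (th + s * z) * (s ^+ 2 * gamma / 2 * b)); last by ring.
  have t1 := cos_lip th (s * z).
  have t2 : `|s * z| <= s * c by rewrite normrM (gtr0_norm s0) ler_wpM2l// ltW.
  have t3 : `|cos (th + s * z) * (s ^+ 2 * gamma / 2 * b)| <= 1 * (s * H).
    rewrite normrM; apply: ler_pM => //; first exact: abs_cos_le1.
    rewrite (normrM (s ^+ 2 * gamma / 2) b); apply: ler_pM => //.
    have gs : s ^+ 2 * gamma <= s.
      rewrite expr2 -mulrA -[leRHS]mulr1 ler_wpM2l ?(ltW s0)//.
      by rewrite -[leRHS]mulr1; apply: ler_pM => //; exact: ltW.
    have sg : 0 <= s ^+ 2 * gamma by apply: mulr_ge0; [exact: sqr_ge0|exact: ltW].
    by rewrite ger0_norm; lra.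
  apply: (le_trans (ler_normB _ _)).
  apply: (le_trans (lerD (le_trans t1 t2) t3)).
  by rewrite mul1r -mulrDr mulrC.
move: e1 e2 Kn.
set I1 := \int[P]_w cos _; set I2 := \int[P]_w Phi _ _ n w.
set I3 := \int[P]_w Phi _ _ 0 w => e1 e2 Kn.
have Kn' : n%:R * (K * s ^+ 3) <= K / (1 - gamma) ^+ 2 * s.
  rewrite -Ns2 (_ : n%:R * _ = K * s * (n%:R * s ^+ 2)); last by ring.
  rewrite (_ : K * (_ * _) * s = K * s * (n.+1%:R * s ^+ 2)); last by ring.
  apply: ler_wpM2l; first by apply: mulr_ge0 => //; exact: ltW.
  by apply: ler_wpM2r; [exact: sqr_ge0|rewrite ler_nat].
have e3 : `|G ^+ n * (I3 - cos th)| <= 1 * (B * s).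
  by rewrite normrM; apply: ler_pM.
have e4 : `|G ^+ n * cos th * (1 - G)| <= 1 * (K3 * s).
  rewrite normrM; apply: ler_pM => //.
    rewrite normrM -[leRHS]mulr1; apply: ler_pM => //; exact: abs_cos_le1.
  have sv0 : 0 <= s ^+ 2 * vbar by apply: mulr_ge0 => //; exact: sqr_ge0.
  have G1 := KgP _ sv0; rewrite -/G distrC in G1.
  have s2 : s ^+ 2 <= s by rewrite expr2 ler_piMr// ltW.
  have s4 : s ^+ 4 <= s.
    by rewrite exprS ler_piMr ?(ltW s0)// exprn_ile1// ltW.
  rewrite (_ : 1 - G = (1 - s ^+ 2 * vbar / 2 - G) + s ^+ 2 * vbar / 2); last by ring.
  apply: (le_trans (ler_normD _ _)).
  rewrite (@ger0_norm _ (s ^+ 2 * vbar / 2)); last by rewrite divr_ge0.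
  have b1 : s ^+ 2 * vbar <= s * vbar by exact: ler_wpM2r.
  have b2 : Kg * (s ^+ 2 * vbar) ^+ 2 <= Kg * vbar ^+ 2 * s.
    rewrite (_ : Kg * _ = Kg * vbar ^+ 2 * s ^+ 4); last by ring.
    by apply: ler_wpM2l => //; apply: mulr_ge0 => //; exact: sqr_ge0.
  apply: (le_trans (lerD (le_trans G1 b2) (lexx _))).
  rewrite /K3 mulrDl (addrC (vbar * s)) lerD2l.
  by move: b1 sv0; rewrite (mulrC s); lra.
rewrite (_ : I1 - _ = - (I2 - I1) + ((I2 - G ^+ n * I3) + (G ^+ n * (I3 - cos th)
   + G ^+ n * cos th * (1 - G)))); last by rewrite exprSr; ring.
apply: (le_trans (ler_normD _ _)); rewrite normrN.
rewrite (_ : (2 * B + _ + _) * s =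
  B * s + (K / (1 - gamma) ^+ 2 * s + (1 * (B * s) + 1 * (K3 * s)))); last by ring.
apply: lerD => //.
apply: (le_trans (ler_normD _ _)); apply: lerD; first exact: le_trans Kn Kn'.
by apply: (le_trans (ler_normD _ _)); exact: lerD.
Qed.

Lemma char_S_cvg (th : R) :
  \int[P]_w cos (th + (Num.sqrt N%:R)^-1 * S N w) @[N --> \oo] -->
  cos th * gauss_char vlim.
Proof.
have [K K0 KP] := char_S_error.
have g1 := gamma_lt1.
have og0 : 0 < 1 - gamma by rewrite subr_gt0.
apply/cvgrPdist_le => ep ep0.
pose r := (1 - gamma)^-1 * (1 + K / ep).
have r0 : 0 < r by rewrite mulr_gt0 ?invr_gt0// ltr_pwDl// divr_ge0// ltW.
near=> N.
have Nr : r ^+ 2 <= N%:R by near: N; exact: nbhs_infty_ger.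
have N0 : (0 < N)%N.
  by rewrite -(ltr_nat R); apply: lt_le_trans Nr; rewrite exprn_gt0.
have [n Nn] : exists n, N = n.+1 by exists N.-1; rewrite prednK.
rewrite Nn in Nr *.
have rN : r <= Num.sqrt n.+1%:R.
  by rewrite -(ger0_norm (ltW r0)) -sqrtr_sqr ler_wsqrtr.
have Kep : 0 <= K / ep by rewrite divr_ge0// ltW.
have sN : 1 + K / ep <= (1 - gamma) * Num.sqrt n.+1%:R.
  by rewrite -ler_pdivrMl.
have s1 : ((1 - gamma) * Num.sqrt n.+1%:R)^-1 <= 1.
  by rewrite invf_le1; [lra|rewrite mulr_gt0// (lt_le_trans r0)].
rewrite distrC; apply: (le_trans (KP th n s1)).
rewrite ler_pdivrMr; last by rewrite mulr_gt0// (lt_le_trans r0).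
rewrite mulrC -ler_pdivrMr//; lra.
Unshelve. all: by end_near. Qed.

(** * Tightness, strong law and return to the vectors *)

(** [S] is [(M - gamma Y) / (1 - gamma)] with [Y] bounded by [c].  The bound is
    uniform in [N], which makes the normalized sums tight. *)
Lemma second_moment_S N :
  \int[P]_w ((Num.sqrt N%:R)^-1 * S N w) ^+ 2 <= 10 * (c / (1 - gamma)) ^+ 2.
Proof.
have og0 : 0 < 1 - gamma by rewrite subr_gt0 gamma_lt1.
have ic (r : R) : P.-integrable setT (EFin \o cst r).
  exact: finite_measure_integrable_cst.
case: N => [|n].
  under eq_Rintegral do rewrite /S big_ord0 mulr0 expr0n.
  by rewrite (Rintegral_probability_cst P 0) mulr_ge0 ?sqr_ge0.
have N0 : 0 < n.+1%:R :> R by [].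
pose a : R := 2 / ((1 - gamma) ^+ 2 * n.+1%:R).
have a0 : 0 <= a by rewrite divr_ge0// mulr_ge0 ?sqr_ge0.
have iaM : P.-integrable setT (EFin \o (fun w => a * M n w ^+ 2)).
  exact: (@integrableZl _ _ _ _ _ measurableT a _ (@int_pow 2 n)).
have iS : P.-integrable setT
    (EFin \o (fun w => ((Num.sqrt n.+1%:R)^-1 * S n.+1 w) ^+ 2)).
  by apply: (@adapted_integrable n.+1) => w w' ww'; rewrite (S_adapted ww').
apply: (@le_trans _ _ (\int[P]_w (a * M n w ^+ 2 + cst (a * c ^+ 2) w))).
  apply: le_Rintegral => //.
    exact: (@integrableD _ _ _ _ _ measurableT _ _ iaM (ic _)).
  move=> w _ /=; have yl := y_draw_le n w.
  have g0 := gamma_gt0; have g1 := gamma_lt1.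
  have z2 : (gamma * y (xi n.+1 w)) ^+ 2 <= c ^+ 2.
    rewrite -[leLHS]real_normK ?num_real// ler_sqr ?nnegrE ?c_ge0//.
    rewrite normrM (gtr0_norm g0) -[leRHS]mul1r.
    by apply: ler_pM => //; exact: ltW.
  rewrite exprMn exprVn sqr_sqrtr ?(ltW N0)//.
  have SM : (1 - gamma) * S n.+1 w = M n w - gamma * y (xi n.+1 w).
    by rewrite /M addrK.
  have S2 : S n.+1 w ^+ 2 =
      (M n w - gamma * y (xi n.+1 w)) ^+ 2 / (1 - gamma) ^+ 2.
    by rewrite -SM exprMn mulrC mulKf// expf_neq0// gt_eqF.
  rewrite S2 -mulrDr.
  move: (M n w) (gamma * y _) z2 => u z z2.
  rewrite (_ : n.+1%:R^-1 * _ = a * ((u - z) ^+ 2 / 2)); last first.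
    by rewrite /a; field; rewrite !gt_eqF.
  apply: ler_wpM2l => //.
  have := sqr_ge0 (u + z).
  rewrite (_ : (u + z) ^+ 2 = u ^+ 2 + 2 * (u * z) + z ^+ 2); last by ring.
  rewrite (_ : (u - z) ^+ 2 = u ^+ 2 - 2 * (u * z) + z ^+ 2); last by ring.
  by lra.
rewrite RintegralD// Rintegral_probability_cst RintegralZl//.
have := ler_wpM2l a0 (second_moment_M n).
move=> /(lerD)/(_ (lexx (a * c ^+ 2)))/le_trans; apply.
rewrite -mulrDr (_ : 10 * _ = a * (5 * c ^+ 2 * n.+1%:R)); last first.
  by rewrite /a; field; rewrite !gt_eqF.
apply: ler_wpM2l => //.
rewrite (_ : 5 * c ^+ 2 * n.+1%:R = (2 * c) ^+ 2 * n.+1%:R + c ^+ 2 * n.+1%:R);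
  last by ring.
by rewrite lerD2l ler_peMr ?sqr_ge0// ler1n.
Qed.

Lemma M_slln : {ae P, forall w, M n w / n.+1%:R @[n --> \oo] --> 0}.
Proof.
pose D := 6 * (2 * c) ^+ 4.
have D0 : 0 <= D by rewrite mulr_ge0// exprn_even_ge0.
have af n : adapted n.+1 (fun w => (M n w / n.+1%:R) ^+ 4).
  by move=> w w' ww'; rewrite (M_adapted ww').
have := @ae_cvg0_summable _ _ _ P (fun n w => (M n w / n.+1%:R) ^+ 4)
  (fun n => D * (n.+1%:R ^+ 2)^-1) (D * 2).
move=> /(_ _ _ _ _)/filterS; apply => //; first last.
- by move=> N; rewrite -mulr_sumr; apply: ler_wpM2l => //; exact: sum_inv_sqr_le.
- move=> n; rewrite (EFin_Rintegral (adapted_integrable (af n))) lee_fin.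
  have n0 : 0 < n.+1%:R :> R by [].
  have -> : \int[P]_w (M n w / n.+1%:R) ^+ 4 =
      (n.+1%:R ^+ 4)^-1 * \int[P]_w M n w ^+ 4.
    rewrite -RintegralZl//.
    by apply: eq_Rintegral => w _; rewrite exprMn exprVn mulrC.
  have h0 : 0 <= (n.+1%:R ^+ 4)^-1 :> R by rewrite invr_ge0 exprn_ge0.
  apply: (le_trans (ler_wpM2l h0 (fourth_moment_M n))).
  by rewrite -/D le_eqVlt; apply/orP; left; apply/eqP; field; rewrite gt_eqF.
- by move=> n w; rewrite exprn_even_ge0.
- by move=> n; exact: adapted_measurable (af n).
move=> w cvg4; apply/cvgrPdist_le => ep ep0.
have /cvgrPdist_le/(_ (ep ^+ 4)) := cvg4.
rewrite exprn_gt0// => /(_ erefl); apply: filterS => n.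
rewrite !sub0r !normrN normrX => hn.
by rewrite -(@ler_pXn2r _ 4)// nnegrE ltW.
Qed.

Lemma S_slln : {ae P, forall w, S n w / n%:R @[n --> \oo] --> 0}.
Proof.
have og0 : 0 < 1 - gamma by rewrite subr_gt0 gamma_lt1.
have := M_slln; apply: filterS => w Mcvg.
rewrite -(cvg_shiftS (fun n => S n w / n%:R)).
have ycvg : gamma * y (xi n.+1 w) * n.+1%:R^-1 @[n --> \oo] --> 0.
  apply/cvgrPdist_le => ep ep0; near=> n.
  rewrite sub0r normrN normrM normfV (@ger0_norm _ n.+1%:R)//.
  rewrite ler_pdivrMr//.
  have yl : `|gamma * y (xi n.+1 w)| <= c.
    have g0 := gamma_gt0; have g1 := gamma_lt1.
    rewrite normrM (gtr0_norm g0) -[leRHS]mul1r.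
    by apply: ler_pM => //; [exact: ltW|exact: ltW|exact: y_draw_le].
  apply: (le_trans yl); rewrite mulrC -ler_pdivrMr//.
  apply: (@le_trans _ _ n%:R); last by rewrite ler_nat.
  by near: n; exact: nbhs_infty_ger.
have : (1 - gamma)^-1 * (M n w / n.+1%:R - gamma * y (xi n.+1 w) * n.+1%:R^-1)
    @[n --> \oo] --> (1 - gamma)^-1 * (0 - 0).
  by apply: cvgM; [exact: cvg_cst|exact: cvgB].
rewrite subrr mulr0; apply: cvg_trans; apply: near_eq_cvg; near=> n.
rewrite -mulrBl /M addrK mulrA mulrA mulVf ?mul1r//.
by rewrite gt_eqF.
Unshelve. all: by end_near. Qed.

Lemma linear_mean N w : (0 < N)%N ->
  (t^T *m (draws_mean xi N w - p0)) 0 0 = S N w / N%:R.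
Proof.
move=> N0; have N1 : N%:R != 0 :> R by rewrite pnatr_eq0 -lt0n.
have -> : draws_mean xi N w - p0 =
    N%:R^-1 *: \sum_(m < N) (xi m.+1 w - p0).
  rewrite /draws_mean sumrB scalerBr; congr (_ - _).
    by rewrite big_add1/= big_mkord.
  by rewrite sumr_const card_ord -[p0 *+ N]scaler_nat scalerA mulVf// scale1r.
rewrite -scalemxAr mxE mulmx_sumr summxE mulrC.
by congr (_ / _); apply: eq_bigr.
Qed.

(** At [N = 0] both sides vanish, since [Num.sqrt 0 = 0] and [0^-1 = 0]. *)
Lemma linear_X N w : (t^T *m X N w) 0 0 = (Num.sqrt N%:R)^-1 * S N w.
Proof.
rewrite /X -scalemxAr mxE; case: N => [|n].
  by rewrite sqrtr0 invr0 !mul0r.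
rewrite linear_mean// mulrCA mulrC; congr (_ * _).
have N0 : 0 < Num.sqrt n.+1%:R :> R by rewrite sqrtr_gt0.
rewrite -[X in _ / X]sqr_sqrtr// expr2 invfM mulrA divff ?mul1r//.
Qed.

Lemma linear_slln :
  {ae P, forall w, (t^T *m (draws_mean xi N w - p0)) 0 0 @[N --> \oo] --> 0}.
Proof.
have := S_slln; apply: filterS => w; apply: cvg_trans; apply: near_eq_cvg.
by exists 1%N => // N /= N1; rewrite linear_mean.
Qed.

Lemma linear_clt_char (th : R) :
  \int[P]_w cos (phase th t (X N w)) @[N --> \oo] --> cos th * gauss_char vlim.
Proof.
have -> : (fun N => \int[P]_w cos (phase th t (X N w))) =
    (fun N => \int[P]_w cos (th + (Num.sqrt N%:R)^-1 * S N w)).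
  by apply/funext => N; apply: eq_Rintegral => w _; rewrite /phase linear_X.
exact: char_S_cvg.
Qed.

Lemma linear_X_adapted N : adapted N (fun w => (t^T *m X N w) 0 0).
Proof. by move=> w w' ww'; rewrite !linear_X (S_adapted ww'). Qed.

Lemma linear_second_moment : exists2 C : R, 0 <= C &
  forall N, \int[P]_w ((t^T *m X N w) 0 0) ^+ 2 <= C.
Proof.
exists (10 * (c / (1 - gamma)) ^+ 2); first by rewrite mulr_ge0// sqr_ge0.
move=> N; under eq_Rintegral do rewrite linear_X.
exact: second_moment_S.
Qed.

End linear_statistic.

Lemma linear_coord (i : 'I_k) (x : 'cV[R]_k) : ((e i)^T *m x) 0 0 = x i 0.
Proof. by rewrite trmx_delta -rowE mxE. Qed.

Lemma urn_slln : {ae P, forall w, draws_mean xi N w @[N --> \oo] --> p0}.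
Proof.
have : {ae P, forall w, forall i : 'I_k,
    ((e i)^T *m (draws_mean xi N w - p0)) 0 0 @[N --> \oo] --> 0}.
  by apply: filter_forall => i; exact: linear_slln.
apply: filterS => w coordw; apply/cvg_ballP => ep ep0.
have : \forall N \near \oo, forall i : 'I_k,
    `|((e i)^T *m (draws_mean xi N w - p0)) 0 0| < ep.
  apply: filter_forall => i.
  have /cvgrPdist_lt/(_ ep ep0) := coordw i.
  by apply: filterS => N; rewrite sub0r normrN.
apply: filterS => N h; split => // i l; rewrite (ord1 l) /ball/= distrC.
by have := h i; rewrite linear_coord !mxE.
Qed.

Lemma urn_X_measurable N : measurable_fun setT (X N : T -> borel_vec R k).
Proof.
apply: measurable_fun_borel_vec => i.
apply: (@adapted_measurable N) => w w' ww'.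
by rewrite -!linear_coord; exact: linear_X_adapted.
Qed.

(** * The Gaussian limit *)

Section limit_law.
Let lambda : R := 1 + 2 * gamma / (1 - gamma).
Let Sigma2 : 'M[R]_k := lambda *: (diag_mx p0^T - p0 *m p0^T).
Let var (t : 'cV[R]_k) : R :=
  lambda * \sum_j p0 j 0 * ((t^T *m (e j - p0)) 0 0) ^+ 2.

Lemma lambda_ge0 : 0 <= lambda.
Proof.
have g0 := gamma_gt0; have g1 := gamma_lt1.
apply: addr_ge0 => //; apply: divr_ge0; last by rewrite subr_ge0 ltW.
by apply: mulr_ge0 => //; exact: ltW.
Qed.

(** The covariance is the average under [p0] of the rank-one matrices
    [(e j - p0) (e j - p0)^T], up to the factor [lambda]. *)
Lemma quadratic_form (t : 'cV[R]_k) : (t^T *m Sigma2 *m t) 0 0 = var t.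
Proof.
have subE (A B : 'M[R]_1) : (A - B) 0 0 = A 0 0 - B 0 0 by rewrite !mxE.
rewrite /var /Sigma2 -scalemxAr -scalemxAl mxE; congr (_ * _).
set m := (t^T *m p0) 0 0.
have mE : m = \sum_j p0 j 0 * t j 0.
  by rewrite /m mxE; apply: eq_bigr => j _; rewrite mxE mulrC.
have -> : \sum_j p0 j 0 * (t^T *m (e j - p0)) 0 0 ^+ 2 =
    \sum_j (p0 j 0 * t j 0 ^+ 2) - m ^+ 2.
  rewrite (eq_bigr (fun j => p0 j 0 * t j 0 ^+ 2 +
     (- (2 * m) * (p0 j 0 * t j 0) + m ^+ 2 * p0 j 0))); last first.
    move=> j _; rewrite mulmxBr subE -/m.
    have -> : (t^T *m e j) 0 0 = t j 0 by rewrite -colE !mxE.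
    by ring.
  by rewrite !big_split/= -!mulr_sumr -mE sum_p0; ring.
rewrite mulmxBr mulmxBl subE; congr (_ - _).
  rewrite -mulmxA mxE; apply: eq_bigr => j _.
  by rewrite mul_diag_mx !mxE expr2 mulrCA.
have -> : t^T *m (p0 *m p0^T) *m t = (t^T *m p0) *m (p0^T *m t).
  by rewrite !mulmxA.
rewrite mxE big_ord1 expr2 -/m; congr (_ * _).
by rewrite mE mxE; apply: eq_bigr => j _; rewrite mxE.
Qed.

(** The vectors are chosen from the decomposition of [quadratic_form]; the
    square roots exist because [lambda] and the entries of [p0] are nonnegative,
    and colours of probability [0] contribute degenerate directions. *)
Lemma urn_gaussian : exists nu : probability (borel_vec R k) R,
  is_gaussian 0 Sigma2 nu.
Proof.
have [nu nuP] := exists_gaussian_sum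
  [seq Num.sqrt (lambda * p0 j 0) *: (e j - p0) | j <- index_enum 'I_k].
exists nu => t V mV; apply: etrans (nuP t V mV) _.
have -> : (t^T *m (0 : 'cV[R]_k)) 0 0 = 0 by rewrite mulmx0 mxE.
rewrite quadratic_form; congr (normal_law 0 _ V).
rewrite /var mulr_sumr big_map; apply: eq_bigr => j _.
rewrite -scalemxAr mxE exprMn sqr_sqrtr ?mulrA//.
by rewrite mulr_ge0 ?lambda_ge0 ?p0_ge0.
Qed.

Lemma urn_clt (nu : probability (borel_vec R k) R) : is_gaussian 0 Sigma2 nu ->
  cvg_in_distribution P X nu.
Proof.
move=> gnu.
have var0 t : 0 <= var t.
  rewrite mulr_ge0 ?lambda_ge0//; apply: sumr_ge0 => j _.
  by rewrite mulr_ge0 ?p0_ge0 ?sqr_ge0.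
have law t (V : set R) : measurable V ->
    nu [set x : 'cV[R]_k | V ((t^T *m x) 0 0)] = normal_law 0 (var t) V.
  move=> mV; apply: etrans (gnu t V mV) _.
  have -> : (t^T *m (0 : 'cV[R]_k)) 0 0 = 0 by rewrite mulmx0 mxE.
  by rewrite quadratic_form.
have mform t := measurable_continuous_borel_vec (@linear_form_continuous R k t).
have /choice[C CP] : forall i : 'I_k, exists C : R, 0 <= C /\
    forall N, \int[P]_w (((e i)^T *m X N w) 0 0) ^+ 2 <= C.
  by move=> i; have [C C0 CP] := linear_second_moment (e i); exists C.
apply: (@cvg_in_distribution_char _ _ _ _ _ _ _ (\sum_i C i)).
- exact: urn_X_measurable.
- move=> N i; apply: (@adapted_integrable N) => w w' ww'.
  by rewrite -!linear_coord (@linear_X_adapted (e i) N w w' ww').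
- move=> N i; have [_ /(_ N)] := CP i.
  under eq_Rintegral do rewrite linear_coord.
  move=> /le_trans; apply; rewrite (bigD1 i)//= lerDl.
  by apply: sumr_ge0 => j _; have [] := CP j.
- move=> i.
  have := normal_variable_sqr_integrable (var0 (e i)) (mform (e i)) (law (e i)).
  by apply: eq_integrable => // x _ /=; rewrite linear_coord.
- move=> th t.
  rewrite (normal_variable_char (var0 t) (mform t) (law t) th).
  have -> : var t = (1 + gamma) / (1 - gamma) *
      \sum_j p0 j 0 * ((t^T *m (e j - p0)) 0 0) ^+ 2.
    rewrite /var /lambda; congr (_ * _); field.
    by rewrite subr_eq0 gt_eqF// gamma_lt1.
  exact: linear_clt_char.
Qed.

End limit_law.

End urn.

(** * Strong law and central limit theorem for the urn *)

Theorem theorem3p1 (R : realType) (d : measure_display) (T : measurableType d)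
    (P : probability T R) (k : nat) (alpha : R) (b0 B0 : 'cV[R]_k)
    (xi : nat -> T -> 'cV[R]_k) (hk : (2 <= k)%N) (halpha : 0 < alpha)
    (hurn : rescaled_polya_urn P alpha 0 b0 B0 xi) :
  let gamma : R := alpha / (norm1 b0 + alpha) in
  let lambda : R := 1 + 2 * gamma / (1 - gamma) in
  let p0 : 'cV[R]_k := (norm1 b0)^-1 *: b0 in
  let Sigma2 : 'M[R]_k := lambda *: (diag_mx p0^T - p0 *m p0^T) in
  [/\ {ae P, forall w, draws_mean xi N w @[N --> \oo] --> p0},
      forall (N : nat) (w : T), (1 <= N)%N ->
        Num.sqrt N%:R *: (draws_mean xi N w - p0) =
        (Num.sqrt N%:R)^-1 *: \sum_(1 <= n < N.+1) (xi n w - p0)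
    & exists nu : probability (borel_vec R k) R,
        is_gaussian 0 Sigma2 nu /\
        cvg_in_distribution P
          (fun N w => Num.sqrt N%:R *: (draws_mean xi N w - p0)) nu].
Proof.
move=> gamma lambda p0 Sigma2; split.
- exact: (urn_slln halpha hurn).
- move=> N w N0.
  have N1 : 0 < Num.sqrt N%:R :> R by rewrite sqrtr_gt0 ltr0n.
  have N2 : N%:R = Num.sqrt N%:R * Num.sqrt N%:R :> R by rewrite -expr2 sqr_sqrtr.
  rewrite /draws_mean sumrB sumr_const_nat subn1/= -[p0 *+ N]scaler_nat.
  rewrite !scalerBr !scalerA; move: (Num.sqrt _) N1 N2 => s s0 ->.
  have s1 : s != 0 by rewrite gt_eqF.
  by congr (_ *: _ - _ *: _); [field|rewrite mulKf].
- have [nu gnu] := urn_gaussian halpha hurn.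
  by exists nu; split => //; exact: (urn_clt halpha hurn gnu).
Qed.
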